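(* Assume that every definable subset of $K$ that is closed, bounded and discrete is finite. Let $I=\{x\in K: |0|<|x|<|1|\}$. There is a parameter-free formula $\mathrm{Int}^\times(h,p,\tau^* )$ in the language $\mathcal L_{\rm ring}\cup\{\mathcal B\}$ such that for every definable set $X\subseteq K^m$ and all $h,p,\tau^*\in\mathcal C(X)$: if $p$ has a unique zero $p_0\in X$, if $X$ has arbitrarily many germs at $p_0$, and if the value $\tau=\tau^*(p_0)$ is in $I$, then $$(\mathcal C(X),\mathcal B)\models\mathrm{Int}^\times(h,p,\tau^* )\iff h(p_0)\in\tau^{\mathbb Z}.$$ If $K$ has a total order $\preccurlyeq$ compatible with $+$ and definable in $\mathcal L_{\rm ring}\cup\{\mathcal O\}$ (no relation between $\mathcal O$ and $\preccurlyeq$ is assumed), then there is similarly a formula $\mathrm{Int}^+_\preccurlyeq(h,p,\tau^* )$ such that, for every definable $X\subseteq K^m$ and $h,p,\tau^*\in\mathcal C(X)$ with the same assumptions on $p$ ($p$ has a unique zero $p_0\in X$ and $X$ has arbitrarily many germs at $p_0$), if $\tau=\tau^*(p_0)\succ0$ then $$(\mathcal C(X),\mathcal B)\models\mathrm{Int}^+_\preccurlyeq(h,p,\tau^* )\iff h(p_0)\in\tau\mathbb Z.$$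
   Context: Setting. $K$ is a field and $\mathcal O\subseteq K$ is either (ordered case) the unit interval $[-1,1]$ of a total order $\le$ making $K$ an ordered field, or (valued case) the valuation ring of a non-trivial valuation $v$ on $K$. $\mathcal K$ is an expansion of $(K,\mathcal O)$: a structure with universe $K$ in a language extending the ring language $\mathcal L_{\rm ring}=\{0,1,+,-,\times\}$ together with a unary predicate for $\mathcal O$. ''Definable'' means first-order definable with parameters (in $\mathcal K$ for subsets of $K^m$); if the formula defining $\preccurlyeq$ uses parameters from $K$, the formula $\mathrm{Int}^+_\preccurlyeq$ may use the corresponding constant functions as parameters. $\mathcal O^\times$ is the set of non-zero $a\in\mathcal O$ with $a^{-1}\in\mathcal O$; $|x|$ is the class of $x\in K^\times$ in $K^\times/\mathcal O^\times$, $|0|=0$, and $|y|\le|x|$ iff $y\in x\mathcal O$ (the usual absolute value in the ordered case, the multiplicatively written valuation in the valued case). For $x\in K^m$, $\|x\|=\max_i|x_i|$; $K^m$ carries the topology given by the open balls for $\|\cdot\|$; ''bounded'' is with respect to $\|\cdot\|$. For definable $X\subseteq K^m$, $\mathcal C(X)$ is the ring (pointwise operations) of continuous definable functions $X\to K$; $\mathcal B=\{s\in\mathcal C(X): s(x)\in\mathcal O\ \forall x\in X\}$; $(\mathcal C(X),\mathcal B)$ is the ring expanded by a unary predicate for $\mathcal B$. Germs. Let $p_0\in X$ and let $U$ be a definable neighborhood of $p_0$ in $X$. A function $s\in\mathcal C(U)$ vanishes on a germ at $p_0$ if $s(p_0)=0$ and $p_0$ is not an isolated point of the zero set $\{s=0\}$.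 Functions $s_1,\dots,s_k\in\mathcal C(U)$ vanish on separated germs at $p_0$ if there are $\delta_1,\dots,\delta_k\in\mathcal C(U\setminus\{p_0\})$ such that: (S1) the sets $S_i=\{s_i=0\}\setminus\{p_0\}$ are pairwise disjoint; (S2) each $s_i$ vanishes on a germ at $p_0$; (S3) for $i\ne j$, $\delta_i$ is constantly $1$ on $S_i$ and constantly $0$ on $S_j$; (S4) each $\delta_i$ is bounded on $U\setminus\{p_0\}$. $X$ has arbitrarily many germs at $p_0$ if for every positive integer $k$ there are a definable neighborhood $U$ of $p_0$ in $X$ and $k$ functions in $\mathcal C(U)$ that vanish on separated germs at $p_0$. $\tau^{\mathbb Z}=\{\tau^k:k\in\mathbb Z\}$ and $\tau\mathbb Z=\{k\tau:k\in\mathbb Z\}$. A total order $\preccurlyeq$ on $K$ is compatible with $+$ if $x\preccurlyeq y$ implies $x+z\preccurlyeq y+z$. *)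

(* Defs.v *)
From HB Require Import structures.
From mathcomp Require Import all_boot all_order all_algebra.
From mathcomp Require Import boolp classical_sets functions cardinality.
From mathcomp Require Import ring lra.

Set Implicit Arguments.
Unset Strict Implicit.
Unset Printing Implicit Defensive.

Import Order.TTheory GRing.Theory Num.Theory.

Local Open Scope classical_set_scope.
Local Open Scope ring_scope.

Record language := Language {
  fun_sym : Type;
  fun_ar : fun_sym -> nat;
  rel_sym : Type;
  rel_ar : rel_sym -> nat
}.

(* [term L n] and [formula L n] have their free variables among 'I_n.  In
   [FEx], variable 0 is the bound one and variable i.+1 is the outer i. *)
Inductive term (L : language) (n : nat) : Type :=
| TVar of 'I_n
| TFun (f : fun_sym L) of ('I_(fun_ar f) -> term L n).

Inductive formula (L : language) (n : nat) : Type :=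
| FEq of term L n & term L n
| FRel (r : rel_sym L) of ('I_(rel_ar r) -> term L n)
| FNot of formula L n
| FAnd of formula L n & formula L n
| FEx of formula L n.+1.

Record structure (L : language) (M : Type) := Structure {
  fun_int : forall f : fun_sym L, (fun_ar f).-tuple M -> M;
  rel_int : forall r : rel_sym L, (rel_ar r).-tuple M -> Prop
}.

Fixpoint eval L M (S : structure L M) n (e : n.-tuple M) (t : term L n) : M :=
  match t with
  | TVar i => tnth e i
  | TFun f args => fun_int S [tuple eval S e (args i) | i < fun_ar f]
  end.

Fixpoint sat L M (S : structure L M) n (e : n.-tuple M) (phi : formula L n)
    : Prop :=
  match phi with
  | FEq t u => eval S e t = eval S e u
  | FRel r args => rel_int S [tuple eval S e (args i) | i < rel_ar r]
  | FNot psi => ~ sat S e psi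
  | FAnd psi1 psi2 => sat S e psi1 /\ sat S e psi2
  | FEx psi => exists a : M, sat S [tuple of a :: e] psi
  end.

Definition definable L M (S : structure L M) m (X : set (m.-tuple M)) : Prop :=
  exists r (a : r.-tuple M) (phi : formula L (m + r)),
    X = [set x : m.-tuple M | sat S [tuple of x ++ a] phi].

Definition lang_sum (L1 L2 : language) : language :=
  @Language (fun_sym L1 + fun_sym L2)
    (fun f => match f with inl g => fun_ar g | inr g => fun_ar g end)
    (rel_sym L1 + rel_sym L2)
    (fun r => match r with inl s => rel_ar s | inr s => rel_ar s end).

Definition structure_sum L1 L2 M (S1 : structure L1 M) (S2 : structure L2 M) :
    structure (lang_sum L1 L2) M :=
  @Structure (lang_sum L1 L2) M
    (fun f => match f return (@fun_ar (lang_sum L1 L2) f).-tuple M -> M with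
              | inl g => @fun_int _ _ S1 g | inr g => @fun_int _ _ S2 g end)
    (fun r => match r return (@rel_ar (lang_sum L1 L2) r).-tuple M -> Prop with
              | inl s => @rel_int _ _ S1 s | inr s => @rel_int _ _ S2 s end).

(* The ring language with one unary predicate, which is interpreted by O in
   K and by B in C(X). *)
Inductive ring_fun := RZero | ROne | RAdd | RSub | RMul.

Definition ring_ar (f : ring_fun) : nat :=
  match f with RZero | ROne => 0 | RAdd | RSub | RMul => 2 end.

Definition ring_pred_lang : language :=
  @Language ring_fun ring_ar unit (fun=> 1%N).

Definition ring_pred_structure (R : pzRingType) (P : set R) :
    structure ring_pred_lang R :=
  @Structure ring_pred_lang R
    (fun f => match f return (ring_ar f).-tuple R -> R with
              | RZero => fun=> 0
              | ROne => fun=> 1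
              | RAdd => fun v => v`_0 + v`_1
              | RSub => fun v => v`_0 - v`_1
              | RMul => fun v => v`_0 * v`_1
              end)
    (fun _ v => P v`_0).

Fixpoint term_ren L n n' (rho : 'I_n -> 'I_n') (t : term L n) : term L n' :=
  match t with
  | TVar i => TVar L (rho i)
  | TFun f args => TFun (fun i => term_ren rho (args i))
  end.

Definition ren_lift n n' (rho : 'I_n -> 'I_n') (i : 'I_n.+1) : 'I_n'.+1 :=
  if unlift ord0 i is Some j then lift ord0 (rho j) else ord0.

Fixpoint formula_ren L n n' (rho : 'I_n -> 'I_n') (phi : formula L n) :
    formula L n' :=
  match phi with
  | FEq t u => FEq (term_ren rho t) (term_ren rho u)
  | FRel r args => FRel (fun i => term_ren rho (args i))
  | FNot psi => FNot (formula_ren rho psi)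
  | FAnd psi1 psi2 => FAnd (formula_ren rho psi1) (formula_ren rho psi2)
  | FEx psi => FEx (formula_ren (ren_lift rho) psi)
  end.

Lemma eval_ren L M (S : structure L M) n n' (rho : 'I_n -> 'I_n')
    (e : n'.-tuple M) (t : term L n) :
  eval S e (term_ren rho t) = eval S [tuple tnth e (rho i) | i < n] t.
Proof.
elim: t => [i|f args IH] /=; first by rewrite tnth_mktuple.
by congr fun_int; apply: eq_from_tnth => i; rewrite !tnth_mktuple.
Qed.

Lemma sat_ren L M (S : structure L M) n n' (rho : 'I_n -> 'I_n')
    (e : n'.-tuple M) (phi : formula L n) :
  sat S e (formula_ren rho phi) <-> sat S [tuple tnth e (rho i) | i < n] phi.
Proof.
elim: phi n' rho e => {n} [n t u|n r args|n psi IH|n p IHp q IHq|n psi IH] n' rho e /=.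
- by rewrite !eval_ren.
- have -> // : [tuple eval S e (term_ren rho (args i)) | i < rel_ar r] =
    [tuple eval S [tuple tnth e (rho i0) | i0 < n] (args i) | i < rel_ar r].
  by apply: eq_from_tnth => i; rewrite !tnth_mktuple eval_ren.
- by rewrite IH.
- by rewrite IHp IHq.
- have E a : [tuple tnth [tuple of a :: e] (ren_lift rho i) | i < n.+1] =
      [tuple of a :: [tuple tnth e (rho i) | i < n]].
    apply: eq_from_tnth => i; rewrite tnth_mktuple /ren_lift.
    by case: unliftP => [j ->|->]; rewrite ?tnthS ?tnth0 ?tnth_mktuple.
  by split=> -[a Ha]; exists a; move: Ha; rewrite IH E.
Qed.

Lemma definable_and L M (S : structure L M) m (X Y : set (m.-tuple M)) :
  definable S X -> definable S Y -> definable S (X `&` Y).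
Proof.
move=> [r [a [phi ->]]] [r' [a' [psi ->]]].
pose f (i : 'I_(m + r)) : 'I_(m + (r + r')) :=
  match fintype.split i with inl j => lshift _ j | inr j => rshift m (lshift r' j) end.
pose g (i : 'I_(m + r')) : 'I_(m + (r + r')) :=
  match fintype.split i with inl j => lshift _ j | inr j => rshift m (rshift r j) end.
exists (r + r')%N, [tuple of a ++ a'], (FAnd (formula_ren f phi) (formula_ren g psi)).
apply/seteqP; split=> x /=; rewrite !sat_ren;
  (suff [-> ->] : [tuple tnth [tuple of x ++ [tuple of a ++ a']] (f i) | i < m + r]
         = [tuple of x ++ a] /\
       [tuple tnth [tuple of x ++ [tuple of a ++ a']] (g i) | i < m + r']
         = [tuple of x ++ a'] by []);
  (split; apply: eq_from_tnth => i; rewrite tnth_mktuple /f /g;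
   by case: (split_ordP i) => j ->; rewrite ?tnth_lshift ?tnth_rshift ?tnth_lshift).
Qed.

Lemma definable_ren L M (S : structure L M) m n (rho : 'I_m -> 'I_n)
    (X : set (m.-tuple M)) :
  definable S X -> definable S [set z : n.-tuple M | X [tuple tnth z (rho i) | i < m]].
Proof.
move=> [r [a [phi ->]]].
pose f (i : 'I_(m + r)) : 'I_(n + r) :=
  match fintype.split i with inl j => lshift _ (rho j) | inr j => rshift n j end.
exists r, a, (formula_ren f phi); apply/seteqP; split=> z /=; rewrite sat_ren;
  (suff -> : [tuple tnth [tuple of z ++ a] (f i) | i < m + r] =
      [tuple of [tuple tnth z (rho i) | i < m] ++ a] by []);
  apply: eq_from_tnth => i; rewrite tnth_mktuple /f;
  by case: (split_ordP i) => j ->; rewrite ?tnth_lshift ?tnth_rshift ?tnth_mktuple.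
Qed.

Lemma definable_ex L M (S : structure L M) m (X : set (m.+1.-tuple M)) :
  definable S X -> definable S [set z : m.-tuple M | exists u, X [tuple of u :: z]].
Proof.
move=> [r [a [phi ->]]]; exists r, a, (FEx (phi : formula L (m + r).+1)).
have E (z : m.-tuple M) u : [tuple of [tuple of u :: z] ++ a] =
    [tuple of u :: [tuple of z ++ a]] by apply: val_inj.
by apply/seteqP; split=> z /= -[u zu]; exists u; move: zu; rewrite E.
Qed.

Definition total_order T (le : rel T) : Prop :=
  [/\ reflexive le, antisymmetric le, transitive le & total le].

Definition compatible_add (V : zmodType) (le : rel V) : Prop :=
  forall x y z, le x y -> le (x + z) (y + z).

Definition ordered_field (K : fieldType) (le : rel K) : Prop :=
  [/\ total_order le, compatible_add le &
      forall x y, le 0 x -> le 0 y -> le 0 (x * y)].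

Definition unit_interval (K : fieldType) (O : set K) : Prop :=
  exists2 le : rel K, ordered_field le & O = [set x | le (-1) x && le x 1].

(* A valuation with additive value group (G, le); v 0 stands for +oo, so the
   actual value of v at 0 is never used. *)
Definition valuation (K : fieldType) (G : zmodType) (le : rel G) (v : K -> G) :
    Prop :=
  [/\ total_order le, compatible_add le,
      forall x y, x != 0 -> y != 0 -> v (x * y) = v x + v y &
      forall x y, x != 0 -> y != 0 -> x + y != 0 ->
        le (v x) (v (x + y)) || le (v y) (v (x + y))].

Definition nontrivial_valuation_ring (K : fieldType) (O : set K) : Prop :=
  exists (G : zmodType) (le : rel G) (v : K -> G),
    [/\ valuation le v, exists2 x, x != 0 & v x != 0 &
        O = [set x | x = 0 \/ le 0 (v x)]].

Record ovfield := OVField {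
  ov_sort :> fieldType;
  ovO : set ov_sort;
  ovOP : unit_interval ovO \/ nontrivial_valuation_ring ovO
}.

Arguments ovO : clear implicits.

Section Topology.
Variable K : ovfield.
Local Notation O := (ovO K).

(* |y| <= |x|, resp. |y| < |x|, in K^* / O^* together with |0| = 0. *)
Definition abs_le (y x : K) : Prop := exists2 a, O a & y = x * a.
Definition abs_lt (y x : K) : Prop := abs_le y x /\ ~ abs_le x y.

Definition norm_le m (x : m.-tuple K) (r : K) : Prop :=
  forall i, abs_le (tnth x i) r.

(* The open ball { x : ||x - c|| < |r| }, for r != 0. *)
Definition oball m (c : m.-tuple K) (r : K) : set (m.-tuple K) :=
  [set x | forall i, abs_lt (tnth x i - tnth c i) r].

Definition bounded_set m (X : set (m.-tuple K)) : Prop :=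
  exists r, forall x, X x -> norm_le x r.

Definition closed_set m (X : set (m.-tuple K)) : Prop :=
  forall x, ~ X x -> exists2 r, r != 0 & oball x r `<=` ~` X.

Definition isolated_point m (X : set (m.-tuple K)) (x : m.-tuple K) : Prop :=
  X x /\ exists2 r, r != 0 & X `&` oball x r `<=` [set x].

Definition discrete_set m (X : set (m.-tuple K)) : Prop :=
  forall x, X x -> isolated_point X x.

Definition is_neighborhood m (X : set (m.-tuple K)) (x : m.-tuple K)
    (U : set (m.-tuple K)) : Prop :=
  [/\ U `<=` X, U x & exists2 r, r != 0 & X `&` oball x r `<=` U].

Definition continuous_fun m (X : set (m.-tuple K)) (f : X -> K) : Prop :=
  forall (x : X) (e : K), e != 0 -> exists2 d, d != 0 &
    forall y : X, oball (\val x) d (\val y) -> abs_lt (f y - f x) e.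

End Topology.

Definition unit_ball_props (K : fieldType) (O : set K) : Prop :=
  [/\ O 1, forall a b, O a -> O b -> O (a * b), forall a, O a \/ O a^-1,
      exists2 c, c != 0 & forall a b, O a -> O b -> O (c * (a - b)) &
      exists2 w, w != 0 & O w /\ ~ O w^-1].

Lemma real_unit_interval_props (R : realFieldType) :
  unit_ball_props [set x : R | (-1 <= x) && (x <= 1)].
Proof.
have n2 : (2%:R : R) != 0 by rewrite pnatr_eq0.
split=> /=.
- by apply/andP; split; lra.
- move=> a b; rewrite -!ler_norml normrM => ha hb.
  by rewrite mulr_ile1.
- move=> a; rewrite -!ler_norml normfV.
  case: (leP `|a| 1) => [|h]; [by left|right].
  by rewrite invf_le1 ?ltW // (lt_trans _ h).
- exists 2^-1; first by rewrite invr_eq0.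
  by move=> a b /andP[? ?] /andP[? ?]; apply/andP; split; lra.
- exists 2^-1; first by rewrite invr_eq0.
  rewrite invrK; split; first by apply/andP; split; lra.
  by move=> /andP[_ ?]; lra.
Qed.

Lemma unit_interval_props (K : fieldType) (O : set K) :
  unit_interval O -> unit_ball_props O.
Proof.
move=> [le [[lexx lea let_ ltot] leD leM] ->].
have sub0 x y : le 0 (y - x) = le x y.
  apply/idP/idP => [/leD -/(_ x)|/leD -/(_ (- x))]; first by rewrite add0r subrK.
  by rewrite subrr.
have nneg x : le x 0 -> le 0 (- x) by rewrite -sub0 sub0r.
have npos x : le 0 x -> le (- x) 0 by move=> h; rewrite -sub0 sub0r opprK.
have add0 x y : le 0 x -> le 0 y -> le 0 (x + y).
  by move=> hx hy; apply: (let_ _ _ _ hy); rewrite -[X in le X _]add0r leD.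
have anti0 x : le 0 x -> le x 0 -> x = 0 by move=> h1 h2; apply: lea; rewrite h1 h2.
pose nrm (x : K) := if le 0 x then x else - x.
pose lt (x y : K) := (y != x) && le x y.
have nrmN x : nrm (- x) = nrm x.
  rewrite /nrm; case: ifP => h1; case: ifP => h2; rewrite ?opprK //.
    by move/npos: h1; rewrite opprK => h1; rewrite (anti0 _ h2 h1) oppr0.
  by have := ltot 0 x; rewrite h2 => /nneg; rewrite h1.
have le0_norm x : le 0 x -> nrm x = x by rewrite /nrm => ->.
pose mix := Num.IntegralDomain_isLeReal.Build K add0 leM anti0 sub0 (ltot 0) nrmN
  le0_norm (fun x y => erefl (lt x y)).
pose R : realFieldType := HB.pack (GRing.Field.sort K) (GRing.Field.class K) mix.
exact: (real_unit_interval_props R).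
Qed.

Lemma valuation_ring_props (K : fieldType) (O : set K) :
  nontrivial_valuation_ring O -> unit_ball_props O.
Proof.
move=> [G [le [v [[[lexx lea let_ ltot] leD vM vD] [x0 x00 vx0] ->]]]].
have v1 : v 1 = 0.
  by apply: (addrI (v 1)); rewrite -vM ?oner_neq0 // mulr1 addr0.
have vN1 : v (-1) = 0.
  have vv : v (-1) + v (-1) = 0 by rewrite -vM ?oppr_eq0 ?oner_neq0 // mulrNN mulr1.
  have := ltot 0 (v (-1)) => /orP[] h; apply: lea; rewrite h ?andbT /=.
    by have := leD _ _ (v (-1)) h; rewrite vv add0r => ->.
  by have := leD _ _ (v (-1)) h; rewrite vv add0r => ->.
have vV x : x != 0 -> v x^-1 = - v x.
  by move=> x0'; apply/eqP; rewrite -addr_eq0 -vM ?invr_eq0 // mulVf // v1.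
have le0N g : le 0 g \/ le 0 (- g).
  have := ltot 0 g => /orP[->|h]; [by left|right].
  by have := leD _ _ (- g) h; rewrite subrr add0r.
have OM a b : (a = 0 \/ le 0 (v a)) -> (b = 0 \/ le 0 (v b)) ->
    a * b = 0 \/ le 0 (v (a * b)).
  case: (eqVneq a 0) => [->|a0]; first by rewrite mul0r; left.
  case: (eqVneq b 0) => [->|b0]; first by rewrite mulr0; left.
  case=> [/eqP|ha]; first by rewrite (negbTE a0).
  case=> [/eqP|hb]; first by rewrite (negbTE b0).
  right; rewrite vM //; apply: (let_ _ _ _ ha).
  by have := leD _ _ (v a) hb; rewrite add0r addrC.
have OV a : (a = 0 \/ le 0 (v a)) \/ (a^-1 = 0 \/ le 0 (v a^-1)).
  case: (eqVneq a 0) => [->|a0]; first by left; left.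
  by rewrite vV //; case: (le0N (v a)); [left; right|right; right].
split=> //=.
- by right; rewrite v1.
- exists 1; rewrite ?oner_neq0 // => a b ha hb; rewrite mul1r.
  have {}hb : - b = 0 \/ le 0 (v (- b)) by rewrite -mulN1r; apply: OM; rewrite ?vN1; auto.
  case: (eqVneq (a - b) 0) => [|ab0]; first by left.
  move: ha hb ab0; move: (- b) => {}b.
  case: (eqVneq a 0) => [->|a0]; first by rewrite add0r.
  case: (eqVneq b 0) => [->|b0]; first by rewrite addr0.
  case=> [/eqP|ha]; first by rewrite (negbTE a0).
  case=> [/eqP|hb]; first by rewrite (negbTE b0).
  move=> ab0.
  by right; case/orP: (vD a b a0 b0 ab0); apply: let_.
- have key x : x != 0 -> v x != 0 -> le 0 (v x) -> exists2 w, w != 0 &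
      (w = 0 \/ le 0 (v w)) /\ ~ (w^-1 = 0 \/ le 0 (v w^-1)).
    move=> xn0 vxn0 h; exists x => //; split; first by right.
    case=> [/eqP|]; first by rewrite invr_eq0 (negbTE xn0).
    rewrite vV // => /leD -/(_ (v x)); rewrite add0r addNr => h'.
    by move/eqP: vxn0; apply; apply: lea; rewrite h h'.
  case: (le0N (v x0)) => h; first exact: key h.
  by apply: (key x0^-1); rewrite ?invr_eq0 ?vV ?oppr_eq0.
Qed.

Lemma ovO_props (K : ovfield) : unit_ball_props (ovO K).
Proof. by case: (ovOP K) => [/unit_interval_props|/valuation_ring_props]. Qed.

Section ContinuityTheory.
Variable K : ovfield.
Local Notation O := (ovO K).

Lemma ovO1 : O 1. Proof. by case: (ovO_props K). Qed.

Lemma ovOM a b : O a -> O b -> O (a * b).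
Proof. by case: (ovO_props K) => _ + _ _ _; apply. Qed.

Lemma ovO0 : O 0.
Proof. by case: (ovO_props K) => O1 _ _ [c _ /(_ _ _ O1 O1)]; rewrite subrr mulr0. Qed.

Lemma abs_lexx (x : K) : abs_le x x.
Proof. by exists 1; [exact: ovO1|rewrite mulr1]. Qed.

Lemma abs_le_trans (y x z : K) : abs_le x y -> abs_le y z -> abs_le x z.
Proof.
by move=> [a Oa ->] [b Ob ->]; exists (b * a); [exact: ovOM|rewrite mulrA].
Qed.

Lemma abs_le_total (x y : K) : abs_le x y \/ abs_le y x.
Proof.
case: (eqVneq x 0) => [->|x0]; first by left; exists 0; [exact: ovO0|rewrite mulr0].
case: (eqVneq y 0) => [->|y0]; first by right; exists 0; [exact: ovO0|rewrite mulr0].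
case: (ovO_props K) => _ _ /(_ (y^-1 * x)) OV _ _; case: OV => h; [left|right].
  by exists (y^-1 * x) => //; rewrite mulVKf.
by exists (y^-1 * x)^-1 => //; rewrite invfM invrK mulrCA mulfV ?mulr1.
Qed.

Lemma abs_leM (x y z t : K) : abs_le x y -> abs_le z t -> abs_le (x * z) (y * t).
Proof.
by move=> [a Oa ->] [b Ob ->]; exists (a * b); [exact: ovOM|rewrite mulrACA].
Qed.

Lemma abs_lt_shrink (e : K) : e != 0 ->
  exists2 d, d != 0 & forall y, abs_le y d -> abs_lt y e.
Proof.
move=> e0; case: (ovO_props K) => _ _ _ _ [w w0 [Ow nOw]].
exists (e * w); first by rewrite mulf_neq0.
move=> y [a Oa ->]; split; first by exists (w * a); rewrite ?mulrA //; exact: ovOM.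
case=> b Ob eE; apply: nOw; have -> : w^-1 = a * b; last exact: ovOM.
apply: (mulfI w0); apply: (mulfI e0); rewrite mulfV // mulr1 {1}eE.
by rewrite !mulrA.
Qed.

Lemma abs_leB_shrink (e : K) : e != 0 ->
  exists2 d, d != 0 & forall x y, abs_le x d -> abs_le y d -> abs_le (x - y) e.
Proof.
move=> e0; case: (ovO_props K) => _ _ _ [c c0 Oc] _.
exists (e * c); first by rewrite mulf_neq0.
move=> _ _ [a Oa ->] [b Ob ->]; exists (c * (a - b)); first exact: Oc.
by rewrite mulrA mulrBr.
Qed.

Lemma abs_leM_shrink (k e : K) : e != 0 ->
  exists2 d, d != 0 & forall x, abs_le x d -> abs_le (k * x) e.
Proof.
move=> e0; case: (eqVneq k 0) => [->|k0].
  by exists 1; rewrite ?oner_neq0 // => x _; exists 0; [exact: ovO0|rewrite mul0r mulr0].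
exists (k^-1 * e); first by rewrite mulf_neq0 ?invr_eq0.
by move=> _ [a Oa ->]; exists a => //; rewrite !mulrA mulfV // mul1r.
Qed.

Variables (m : nat) (X : set (m.-tuple K)).

Definition evly (x : X) (P : X -> Prop) : Prop :=
  exists2 d, d != 0 & forall y : X, oball (\val x) d (\val y) -> P y.

Lemma evly_and x P Q : evly x P -> evly x Q -> evly x (fun y => P y /\ Q y).
Proof.
have sub (d d' : K) : abs_le d d' -> oball (\val x) d `<=` oball (\val x) d'.
  move=> dd' y yd i; case: (yd i) => h1 h2; split; first exact: abs_le_trans dd'.
  by move=> h3; apply: h2; exact: abs_le_trans h3.
move=> [d d0 dP] [d' d'0 dQ]; case: (abs_le_total d d') => h.
  by exists d => // y yd; split; [exact: dP|apply: dQ; exact: sub yd].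
by exists d' => // y yd; split; [apply: dP; exact: sub yd|exact: dQ].
Qed.

Lemma evly_sub x (P Q : X -> Prop) : (forall y, P y -> Q y) -> evly x P -> evly x Q.
Proof. by move=> PQ [d d0 dP]; exists d => // y /dP /PQ. Qed.

Lemma continuous_funP (f : X -> K) : continuous_fun f <->
  forall x e, e != 0 -> evly x (fun y => abs_le (f y - f x) e).
Proof.
split=> [fc x e e0|fc x e e0].
  by apply: evly_sub (fc x e e0) => y [].
have [d d0 dP] := abs_lt_shrink e0.
by apply: evly_sub (fc x d d0) => y; exact: dP.
Qed.

Lemma continuous_cst (c : K) : continuous_fun (fun _ : X => c).
Proof.
apply/continuous_funP => x e e0; exists 1; rewrite ?oner_neq0 // => y _.
by exists 0; [exact: ovO0|rewrite subrr mulr0].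
Qed.

Lemma continuousB (f g : X -> K) :
  continuous_fun f -> continuous_fun g -> continuous_fun (fun x => f x - g x).
Proof.
move=> /continuous_funP fc /continuous_funP gc; apply/continuous_funP => x e e0.
have [d d0 dP] := abs_leB_shrink e0.
apply: evly_sub (evly_and (fc x d d0) (gc x d d0)) => y [hf hg].
by have := dP _ _ hf hg; congr abs_le; ring.
Qed.

Lemma continuousM (f g : X -> K) :
  continuous_fun f -> continuous_fun g -> continuous_fun (fun x => f x * g x).
Proof.
move=> /continuous_funP fc /continuous_funP gc; apply/continuous_funP => x e e0.
have [d d0 dP] := abs_leB_shrink e0.
have [d' d'0 d'P] := abs_leB_shrink d0.
have [df df0 dfP] := abs_leM_shrink (- f x) d'0.
have [dg dg0 dgP] := abs_leM_shrink (g x) d'0.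
have := evly_and (evly_and (fc x d d0) (fc x dg dg0))
                 (evly_and (gc x df df0) (gc x 1 (oner_neq0 _))).
apply: evly_sub => y [[h1 h2] [h3 h4]].
have h5 := abs_leM h1 h4; rewrite mulr1 in h5.
by have := dP _ _ h5 (d'P _ _ (dfP _ h3) (dgP _ h2)); congr abs_le; ring.
Qed.

End ContinuityTheory.

(* Up to renaming of symbols, every expansion of (K, O) has this form. *)
Definition expansion (K : ovfield) (L : language) (S : structure L K) :
    structure (lang_sum ring_pred_lang L) K :=
  structure_sum (ring_pred_structure (ovO K)) S.

Definition graph (T : Type) m (X : set (m.-tuple T)) (f : X -> T) :
    set ((m + 1).-tuple T) :=
  [set z | exists x : X, z = [tuple of \val x ++ [:: f x]]].

Section DefinableTheory.
Variables (K : ovfield) (L : language) (S : structure L K).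
Local Notation ES := (expansion S).

Local Notation i0 := (@Ordinal 3 0 isT).
Local Notation i1 := (@Ordinal 3 1 isT).
Local Notation i2 := (@Ordinal 3 2 isT).

Lemma mktuple2_nth (F : 'I_2 -> K) :
  (mktuple F)`_0 = F ord0 /\ (mktuple F)`_1 = F ord_max.
Proof.
split; first by rewrite -(tnth_nth 0 (mktuple F) ord0) tnth_mktuple.
by rewrite -(tnth_nth 0 (mktuple F) ord_max) tnth_mktuple.
Qed.

Lemma definable_sub :
  definable ES [set z : 3.-tuple K | tnth z i2 = tnth z i0 - tnth z i1].
Proof.
pose LL := lang_sum ring_pred_lang L.
exists 0%N, [tuple], (FEq (TVar LL (i2 : 'I_(3 + 0))) (@TFun LL (3 + 0) (inl RSub)
  (fun i : 'I_2 => TVar LL (if val i == 0%N then i0 else i1)))).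
by apply/seteqP; split=> z; rewrite /sat /= !(mktuple2_nth _).1 !(mktuple2_nth _).2
  /= !(tnth_nth 0) /= !cats0.
Qed.

Lemma definable_mul :
  definable ES [set z : 3.-tuple K | tnth z i2 = tnth z i0 * tnth z i1].
Proof.
pose LL := lang_sum ring_pred_lang L.
exists 0%N, [tuple], (FEq (TVar LL (i2 : 'I_(3 + 0))) (@TFun LL (3 + 0) (inl RMul)
  (fun i : 'I_2 => TVar LL (if val i == 0%N then i0 else i1)))).
by apply/seteqP; split=> z; rewrite /sat /= !(mktuple2_nth _).1 !(mktuple2_nth _).2
  /= !(tnth_nth 0) /= !cats0.
Qed.

Lemma definable_cst (c : K) : definable ES [set z : 1.-tuple K | tnth z ord0 = c].
Proof.
pose LL := lang_sum ring_pred_lang L.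
exists 1%N, [tuple c], (FEq (TVar LL (lshift 1 ord0 : 'I_(1 + 1)))
  (TVar LL (rshift 1 ord0))).
have E1 (z : 1.-tuple K) : tnth [tuple of z ++ [tuple c]] (lshift 1 ord0) = tnth z ord0.
  by rewrite tnth_lshift.
have E2 (z : 1.-tuple K) : tnth [tuple of z ++ [tuple c]] (rshift 1 ord0) = c.
  by rewrite tnth_rshift.
apply/seteqP; split=> z h.
  exact: (etrans (E1 z) (etrans h (esym (E2 z)))).
exact: (etrans (esym (E1 z)) (etrans h (E2 z))).
Qed.

Lemma definable_graph_op m (X : set (m.-tuple K)) (op : K -> K -> K) (f g : X -> K) :
  definable ES [set z : 3.-tuple K | tnth z i2 = op (tnth z i0) (tnth z i1)] ->
  definable ES (graph f) -> definable ES (graph g) ->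
  definable ES (graph (fun x => op (f x) (g x))).
Proof.
move=> dop df dg.
pose l2 (i : 'I_(m + 1)) : 'I_(m + 1).+2 := lift ord0 (lift ord0 i).
pose rf (i : 'I_(m + 1)) : 'I_(m + 1).+2 :=
  if fintype.split i is inl j then l2 (lshift 1 j) else ord0.
pose rg (i : 'I_(m + 1)) : 'I_(m + 1).+2 :=
  if fintype.split i is inl j then l2 (lshift 1 j) else lift ord0 ord0.
pose ro (i : 'I_3) : 'I_(m + 1).+2 :=
  if val i == 0%N then ord0 else if val i == 1%N then lift ord0 ord0
  else l2 (rshift m ord0).
have := definable_ex (definable_ex (definable_and
  (definable_and (definable_ren rf df) (definable_ren rg dg)) (definable_ren ro dop))).
congr definable.
pose tk (z : (m + 1).-tuple K) := [tuple tnth z (lshift 1 j) | j < m].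
have Ef (z : (m + 1).-tuple K) (u v : K) :
    [tuple tnth [tuple of u :: [tuple of v :: z]] (rf i) | i < m + 1]
    = [tuple of tk z ++ [:: u]].
  apply: eq_from_tnth => i; rewrite tnth_mktuple /rf.
  case: (split_ordP i) => j ->; rewrite ?tnthS ?tnth0.
    by rewrite tnth_lshift tnth_mktuple.
  by rewrite (tnth_rshift _ [tuple u]) ord1.
have Eg (z : (m + 1).-tuple K) (u v : K) :
    [tuple tnth [tuple of u :: [tuple of v :: z]] (rg i) | i < m + 1]
    = [tuple of tk z ++ [:: v]].
  apply: eq_from_tnth => i; rewrite tnth_mktuple /rg.
  case: (split_ordP i) => j ->; rewrite ?tnthS ?tnth0.
    by rewrite tnth_lshift tnth_mktuple.
  by rewrite (tnth_rshift _ [tuple v]) ord1.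
have Ez (z : (m + 1).-tuple K) : z = [tuple of tk z ++ [:: tnth z (rshift m ord0)]].
  apply: eq_from_tnth => i; case: (split_ordP i) => j ->.
    by rewrite tnth_lshift tnth_mktuple.
  by rewrite (tnth_rshift _ [tuple tnth z (rshift m ord0)]) ord1.
have inj (y y' : m.-tuple K) (u u' : K) :
    [tuple of y ++ [:: u]] = [tuple of y' ++ [:: u']] -> y = y' /\ u = u'.
  move=> /(congr1 val) /= /eqP; rewrite eqseq_cat ?size_tuple // => /andP[/eqP h /eqP[->]].
  by split=> //; apply: val_inj.
apply/seteqP; split=> z /=.
  move=> [v [u]]; rewrite Ef Eg !tnth_mktuple /ro /= ?tnthS ?tnth0.
  move=> [[[x Ex] [x' Ex']] opz].
  have [xz uf] := inj _ _ _ _ Ex; have [x'z vg] := inj _ _ _ _ Ex'.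
  have xx' : x' = x by apply: val_inj; rewrite -[LHS]x'z.
  by exists x; rewrite [LHS]Ez; apply: val_inj; move/(congr1 val): xz => /= ->; rewrite opz uf vg xx'.
move=> [x Ex]; exists (g x), (f x); rewrite Ef Eg !tnth_mktuple /ro /= ?tnthS ?tnth0.
have [xz uf] := inj _ _ _ _ (etrans (esym (Ez z)) Ex).
by split; [split; exists x; apply: val_inj; move/(congr1 val): xz => /= ->|].
Qed.

Lemma definable_graph_cst m (X : set (m.-tuple K)) (c : K) :
  definable ES X -> definable ES (graph (fun _ : X => c)).
Proof.
move=> dX.
have := definable_and (definable_ren (lshift 1 : 'I_m -> 'I_(m + 1)) dX)
  (definable_ren (fun _ : 'I_1 => rshift m (ord0 : 'I_1)) (definable_cst c)).
congr definable; apply/seteqP; split=> z /=.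
  rewrite tnth_mktuple => -[Xz zc]; exists (SigSub (mem_set Xz)) => /=.
  apply: eq_from_tnth => i; case: (split_ordP i) => j ->.
    by rewrite tnth_lshift tnth_mktuple.
  by rewrite (tnth_rshift _ [tuple c]) ord1.
move=> [x ->]; rewrite tnth_mktuple (tnth_rshift _ [tuple c]); split=> //.
have -> : [tuple tnth [tuple of \val x ++ [:: c]] (lshift 1 i) | i < m] = \val x.
  by apply: eq_from_tnth => i; rewrite tnth_mktuple tnth_lshift.
exact: set_mem (valP x).
Qed.

End DefinableTheory.

Definition continuous_definable (K : ovfield) (L : language) (S : structure L K) m
    (X : set (m.-tuple K)) (f : X -> K) : Prop :=
  continuous_fun f /\ definable (expansion S) (graph f).

Record definable_set (K : ovfield) (L : language) (S : structure L K) (m : nat) :=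
  DefinableSet {
    dset :> set (m.-tuple K);
    dsetP : definable (expansion S) dset
  }.

Section FunctionRing.
Variables (K : ovfield) (L : language) (S : structure L K).
Variables (m : nat) (X : definable_set S m).

Definition cdfun_pred : {pred (X -> K)} :=
  [pred f : X -> K | `[< continuous_definable S f >]].

Lemma cdfun_subring : subring_closed cdfun_pred.
Proof.
split=> [|f g /asboolP[fc fd] /asboolP[gc gd]|f g /asboolP[fc fd] /asboolP[gc gd]];
  apply/asboolP; split.
- exact: continuous_cst.
- exact: definable_graph_cst (dsetP X).
- exact: (continuousB fc gc).
- exact: (definable_graph_op (op := fun a b => a - b) (definable_sub S) fd gd).
- exact: (continuousM fc gc).
- exact: (definable_graph_op (op := fun a b => a * b) (definable_mul S) fd gd).
Qed.

Record cdfun := CDFun { cdfun_val :> X -> K; cdfun_valP : cdfun_val \in cdfun_pred }.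

HB.instance Definition _ := [isSub for cdfun_val].
HB.instance Definition _ := [Choice of cdfun by <:].
HB.instance Definition _ :=
  GRing.SubChoice_isSubComPzRing.Build (X -> K) cdfun_pred cdfun cdfun_subring.

Lemma cdfun_cst_subproof (c : K) : (fun _ : X => c) \in cdfun_pred.
Proof.
apply/asboolP; split; first exact: continuous_cst.
exact: definable_graph_cst (dsetP X).
Qed.

Definition cdfun_cst (c : K) : cdfun := CDFun (cdfun_cst_subproof c).

Definition cdfun_structure : structure ring_pred_lang cdfun :=
  ring_pred_structure [set s : cdfun | forall x : X, ovO K (s x)].

End FunctionRing.

Section Germs.
Variables (K : ovfield) (L : language) (S : structure L K) (m : nat).
Implicit Types (X U : set (m.-tuple K)) (p : m.-tuple K).

Definition zero_set U (s : U -> K) : set (m.-tuple K) :=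
  [set x | exists2 q : U, \val q = x & s q = 0].

Definition vanishes_on_germ U p (s : U -> K) : Prop :=
  zero_set s p /\ ~ isolated_point (zero_set s) p.

Definition separated_germs U p k (s : 'I_k -> U -> K) : Prop :=
  exists delta : 'I_k -> U `\ p -> K,
    (forall i, continuous_definable S (delta i)) /\
    [/\ forall i j, i != j ->
          (zero_set (s i) `\ p) `&` (zero_set (s j) `\ p) = set0,
        forall i, vanishes_on_germ p (s i),
        forall i j, i != j -> forall x : U `\ p,
          (zero_set (s i) (\val x) -> delta i x = 1) /\
          (zero_set (s j) (\val x) -> delta i x = 0) &
        forall i, exists r, forall x, abs_le (delta i x) r].

Definition arbitrarily_many_germs X p : Prop :=
  forall k : nat, (0 < k)%N -> exists U (s : 'I_k -> U -> K),
    [/\ definable (expansion S) U, is_neighborhood X p U,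
        forall i, continuous_definable S (s i) & separated_germs p s].

End Germs.

(* Main.v *)
(* An element h of C(X) stands for the value h(p0).  As p0 is the only zero of p
   and any two functions without common zero generate the unit ideal,
   h(p0) = 0 means that p and h do not generate it; similarly "s and w have a
   common zero outside the zeros of v" is first-order, because 1 - v / v(x)
   vanishes at x and nowhere on {v = 0}.  Hence the set A of cluster values at p0
   of f / g along {s = 0} is definable in (C(X), B) by a formula in f, g, s, p,
   and it is also a definable subset of K.  When the formula says that A is
   bounded and uniformly separated, A is finite by hypothesis; when moreover A
   contains a / tau for each a in A other than 1, every nonzero a in A is a power
   of tau, for otherwise a, a / tau, a / tau^2, ... would be infinitely many
   elements of A.  Conversely {1, tau, ..., tau^n} is such a set A: with
   separated germs s_i and a bump function q at p0, take g = q p,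
   s = q prod_i s_i and f = q p sum_i tau^i delta_i.  The additive case is the
   same with subtraction of tau. *)
Require Import Defs.
From HB Require Import structures.
From mathcomp Require Import all_boot all_order all_algebra.
From mathcomp Require Import boolp classical_sets functions cardinality.
From mathcomp Require Import ring lra.

Set Implicit Arguments.
Unset Strict Implicit.
Unset Printing Implicit Defensive.

Import Order.TTheory GRing.Theory Num.Theory.

Local Open Scope classical_set_scope.
Local Open Scope ring_scope.

(** * Uniformly definable predicates *)

Section UniformDefinability.
Variables (L : language) (I : Type) (M : I -> pzRingType).
Variables (S : forall i, structure L (M i)) (C : Type) (cst : forall i, C -> M i).

Definition assign i (rho : nat -> M i) (v : nat + C) : M i :=
  match v with inl k => rho k | inr c => cst i c end.

(* One formula has to work for all [i]; each of its variables is read off the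
   valuation [rho] or is a constant from [C]. *)
Definition udef (P : forall i, (nat -> M i) -> Prop) : Prop :=
  exists N (phi : formula L N) (v : 'I_N -> nat + C), forall i rho,
    P i rho <-> sat (S i) [tuple assign rho (v j) | j < N] phi.

(** Functions enter through their graphs, because a definable [t] need not be given by a term. *)
Definition udef_fun (t : forall i, (nat -> M i) -> M i) : Prop :=
  udef (fun i rho => rho 0%N = t i (fun n => rho n.+1)).

Implicit Types P Q : forall i, (nat -> M i) -> Prop.

Lemma udef_iff P Q : (forall i rho, P i rho <-> Q i rho) -> udef P -> udef Q.
Proof.
by move=> PQ [N [phi [v Hv]]]; exists N, phi, v => i rho; rewrite -PQ.
Qed.

Lemma udef_not P : udef P -> udef (fun i rho => ~ P i rho).
Proof.
by move=> [N [phi [v Hv]]]; exists N, (FNot phi), v => i rho; rewrite Hv.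
Qed.

Lemma udef_and P Q : udef P -> udef Q -> udef (fun i rho => P i rho /\ Q i rho).
Proof.
move=> [N [phi [v Hv]]] [N' [phi' [v' Hv']]].
exists (N + N')%N, (FAnd (formula_ren (@lshift N N') phi)
  (formula_ren (@rshift N N') phi')),
  (fun j => match fintype.split j with inl k => v k | inr k => v' k end) => i rho.
rewrite /= !sat_ren Hv Hv'.
set a := mktuple _; set b := mktuple _; set a' := mktuple _; set b' := mktuple _.
suff [-> ->] : a = a' /\ b = b' by [].
split; apply: eq_from_tnth => j; rewrite !tnth_mktuple.
  by case: split_ordP => k /eqP; rewrite ?eq_lshift ?eq_lrshift // => /eqP ->.
by case: split_ordP => k /eqP; rewrite ?eq_rlshift ?eq_rshift // => /eqP ->.
Qed.

Lemma udef_ren (s : nat -> nat) P :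
  udef P -> udef (fun i rho => P i (fun n => rho (s n))).
Proof.
move=> [N [phi [v Hv]]].
exists N, phi, (fun j => match v j with inl k => inl (s k) | inr c => inr c end).
move=> i rho; rewrite Hv.
set a := mktuple _; set b := mktuple _; suff -> : a = b by [].
by apply: eq_from_tnth => j; rewrite !tnth_mktuple; case: (v j).
Qed.

Lemma udef_ex (Q : forall i, (nat -> M i) -> M i -> Prop) :
  udef (fun i rho => Q i (fun n => rho n.+1) (rho 0%N)) ->
  udef (fun i rho => exists u, Q i rho u).
Proof.
move=> [N [phi [v Hv]]].
(* Entries of [phi] that read variable 0 become the quantified variable; their old slots keep a
   dummy assignment that nothing reads. *)
exists N, (FEx (formula_ren (fun j : 'I_N =>
    match v j with inl 0%N => ord0 | _ => lift ord0 j end) phi)),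
  (fun j => match v j with inl k.+1 => inl k | _ => v j end).
move=> i rho /=.
have E u : Q i rho u <-> sat (S i) [tuple assign
    (fun n => if n is k.+1 then rho k else u) (v j) | j < N] phi.
  by rewrite -(Hv i (fun n => if n is k.+1 then rho k else u)).
split=> -[u Hu]; exists u; move: Hu; rewrite sat_ren E;
  (set a := (X in sat _ X _ -> _); set b := (X in _ -> sat _ X _));
  (suff -> : a = b by []);
  apply: eq_from_tnth => j; rewrite !tnth_mktuple;
  by case Ej: (v j) => [[|k]|c]; rewrite ?tnth0 ?tnthS ?tnth_mktuple ?Ej.
Qed.

Lemma udef_or P Q : udef P -> udef Q -> udef (fun i rho => P i rho \/ Q i rho).
Proof.
move=> /udef_not dP /udef_not dQ.
apply: udef_iff (udef_not (udef_and dP dQ)) => i rho.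
by rewrite not_andP !notK.
Qed.

Lemma udef_imp P Q : udef P -> udef Q -> udef (fun i rho => P i rho -> Q i rho).
Proof.
move=> /udef_not dP dQ.
by apply: udef_iff (udef_or dP dQ) => i rho; rewrite implyE.
Qed.

Lemma udef_all (Q : forall i, (nat -> M i) -> M i -> Prop) :
  udef (fun i rho => Q i (fun n => rho n.+1) (rho 0%N)) ->
  udef (fun i rho => forall u, Q i rho u).
Proof.
move=> dQ.
have := udef_not (udef_ex (Q := fun i rho u => ~ Q i rho u) (udef_not dQ)).
apply: udef_iff => i rho; split=> [h u|h [u]//]; apply: contrapT => nQ.
by apply: h; exists u.
Qed.

Lemma udef_fun_shift t :
  udef_fun t -> udef_fun (fun i rho => t i (fun n => rho n.+1)).
Proof. exact: (udef_ren (fun n => if n is k.+1 then k.+2 else 0%N)). Qed.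

Lemma udef_fun_shift2 t :
  udef_fun t -> udef_fun (fun i rho => t i (fun n => rho n.+2)).
Proof. by move=> /udef_fun_shift/udef_fun_shift. Qed.

(** As [t] is known only through its graph, it cannot be plugged into a formula;
    [exists u, u = t /\ Q u] replaces the substitution. *)
Lemma udef_subst (Q : forall i, (nat -> M i) -> M i -> Prop) t :
  udef_fun t -> udef (fun i rho => Q i (fun n => rho n.+1) (rho 0%N)) ->
  udef (fun i rho => Q i rho (t i rho)).
Proof.
move=> dt dQ; have := udef_ex (Q := fun i rho u => u = t i rho /\ Q i rho u)
  (udef_and dt dQ).
by apply: udef_iff => i rho; split=> [[u [->]]//|h]; exists (t i rho).
Qed.

Lemma udef_eqvar : udef (fun i rho => rho 0%N = rho 1%N).
Proof.
exists 2, (FEq (TVar L ord0) (TVar L ord_max)), (fun j => inl (val j)).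
by move=> i rho /=; rewrite !tnth_mktuple.
Qed.

Lemma udef_fun_var k : udef_fun (fun i rho => rho k).
Proof. exact: (udef_ren (fun n => if n is 0%N then 0%N else k.+1) udef_eqvar). Qed.

Lemma udef_fun_cst c : udef_fun (fun i rho => cst i c).
Proof.
exists 2, (FEq (TVar L ord0) (TVar L ord_max)),
  (fun j : 'I_2 => if val j is 0%N then inl 0%N else inr c).
by move=> i rho /=; rewrite !tnth_mktuple.
Qed.

Lemma udef_eq t u : udef_fun t -> udef_fun u ->
  udef (fun i rho => t i rho = u i rho).
Proof.
move=> dt du; apply: (udef_subst (Q := fun i rho x => x = u i rho) dt).
apply: (udef_subst (Q := fun i rho x => rho 0%N = x) (udef_fun_shift du)).
exact: (udef_ren (fun n => if n is 0%N then 1%N else 0%N) udef_eqvar).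
Qed.

Lemma udef_op (op : forall i, M i -> M i -> M i) t u :
  udef (fun i rho => rho 0%N = op i (rho 1%N) (rho 2%N)) ->
  udef_fun t -> udef_fun u -> udef_fun (fun i rho => op i (t i rho) (u i rho)).
Proof.
move=> dop dt du.
apply: (udef_subst (Q := fun i rho x => rho 0%N = op i x (u i (fun n => rho n.+1)))
  (udef_fun_shift dt)).
apply: (udef_subst (Q := fun i rho x => rho 1%N = op i (rho 0%N) x)
  (udef_fun_shift2 du)).
(* After the two substitutions variable 0 is the second argument, 1 the first and 2 the value. *)
exact: (udef_ren (fun n => match n with 0 => 2 | 1 => 1 | _ => 0 end%N) dop).
Qed.

Lemma udef_allI (J : finType) (P : J -> forall i, (nat -> M i) -> Prop) :
  (forall j, udef (P j)) -> udef (fun i rho => forall j, P j i rho).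
Proof.
move=> dP.
suff H (s : seq J) : udef (fun i rho => forall j, j \in s -> P j i rho).
  apply: udef_iff (H (enum J)) => i rho.
  by split=> h j; [apply: h; rewrite mem_enum|move=> _; exact: h].
elim: s => [|a s IH].
  by apply: udef_iff (udef_eq (udef_fun_var 0) (udef_fun_var 0)) => i rho.
apply: udef_iff (udef_and (dP a) IH) => i rho; split=> [[Pa Ps] j|h].
  by rewrite inE => /predU1P[->//|/Ps].
by split=> [|j js]; apply: h; rewrite inE ?eqxx ?js ?orbT.
Qed.

Lemma udef_extuple k (Q : forall i, (nat -> M i) -> k.-tuple (M i) -> Prop) :
  udef (fun i rho => Q i (fun n => rho (k + n)%N) [tuple rho (val j) | j < k]) ->
  udef (fun i rho => exists x, Q i rho x).
Proof.
elim: k Q => [|k IH] Q dQ.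
  apply: udef_iff dQ => i rho; split=> [h|[x]]; first by eexists; exact: h.
  by have -> : x = [tuple rho (val j) | j < 0] by apply: eq_from_tnth => -[].
have := IH (fun i rho x => exists u, Q i rho [tuple of u :: x]).
case.
  apply: (udef_ex (Q := fun i rho u => Q i (fun n => rho (k + n)%N)
     [tuple of u :: [tuple rho (val j) | j < k]])).
  apply: udef_iff dQ => i rho.
  suff -> : [tuple rho (val j) | j < k.+1] =
    [tuple of rho 0%N :: [tuple rho (val j).+1 | j < k]] by [].
  apply: eq_from_tnth => j; rewrite tnth_mktuple.
  by case: (unliftP ord0 j) => [j' ->|->]; rewrite ?tnthS ?tnth0 ?tnth_mktuple.
move=> N [phi [v Hv]]; exists N, phi, v => i rho; rewrite -Hv.
split=> [[x Qx]|[x [u Qx]]]; last by exists [tuple of u :: x].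
exists [tuple of behead x], (thead x).
by rewrite -tuple_eta.
Qed.

End UniformDefinability.

(** * Definability of ring expressions *)

Section RingAtoms.
Variables (L : language) (I : Type) (M : I -> pzRingType).
Variables (S : forall i, structure L (M i)) (C : Type) (cst : forall i, C -> M i).
Variable B : forall i, set (M i).
Local Notation udef := (udef S cst).
Local Notation udef_fun := (udef_fun S cst).

(** Isolating the atomic cases lets the same closure lemmas serve the family of all rings with a
    subset as well as the single field [K]. *)
Record ring_atoms : Prop := RingAtoms {
  udef_atom_sub : udef (fun i rho => rho 0%N = rho 1%N - rho 2%N);
  udef_atom_mul : udef (fun i rho => rho 0%N = rho 1%N * rho 2%N);
  udef_atom_one : udef (fun i rho => rho 0%N = 1);
  udef_atom_pred : udef (fun i rho => B (rho 0%N))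
}.

Hypothesis HA : ring_atoms.
Implicit Types t u : forall i, (nat -> M i) -> M i.

Lemma udef_fun_sub t u :
  udef_fun t -> udef_fun u -> udef_fun (fun i rho => t i rho - u i rho).
Proof. exact: (udef_op (op := fun i x y => x - y) (udef_atom_sub HA)). Qed.

Lemma udef_fun_mul t u :
  udef_fun t -> udef_fun u -> udef_fun (fun i rho => t i rho * u i rho).
Proof. exact: (udef_op (op := fun i x y => x * y) (udef_atom_mul HA)). Qed.

Lemma udef_fun_one : udef_fun (fun i rho => 1).
Proof. exact: (udef_atom_one HA). Qed.

Lemma udef_fun_zero : udef_fun (fun i rho => 0).
Proof.
apply: udef_iff (udef_fun_sub udef_fun_one udef_fun_one) => i rho.
by rewrite subrr.
Qed.

Lemma udef_fun_add t u :
  udef_fun t -> udef_fun u -> udef_fun (fun i rho => t i rho + u i rho).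
Proof.
move=> dt du; apply: udef_iff (udef_fun_sub dt (udef_fun_sub udef_fun_zero du)) => i rho.
by rewrite sub0r opprK.
Qed.

Lemma udef_pred t : udef_fun t -> udef (fun i rho => B (t i rho)).
Proof.
by move=> dt; apply: (udef_subst (Q := fun i rho x => B x) dt (udef_atom_pred HA)).
Qed.

End RingAtoms.

(** * Parameter-free definability, uniform in the ring *)

Section RingPred.

(** Indexing by every ring with a subset, and allowing no constants, turns [udef] into definability
    by one parameter-free formula valid for all [X] at once. *)
Definition ring_pred := {R : pzRingType & set R}.
Definition ring_pred_sort (i : ring_pred) : pzRingType := projT1 i.
Definition ring_pred_set (i : ring_pred) : set (ring_pred_sort i) := projT2 i.
Definition ring_pred_str (i : ring_pred) :
    structure ring_pred_lang (ring_pred_sort i) :=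
  ring_pred_structure (@ring_pred_set i).
Definition no_cst (i : ring_pred) (c : void) : ring_pred_sort i := of_void _ c.

Lemma mktuple_nth0 (R : nmodType) n (F : 'I_n.+1 -> R) : (mktuple F)`_0 = F ord0.
Proof. by rewrite -(tnth_nth 0 (mktuple F) ord0) tnth_mktuple. Qed.

Lemma mktuple_nth1 (R : nmodType) (F : 'I_2 -> R) : (mktuple F)`_1 = F ord_max.
Proof. by rewrite -(tnth_nth 0 (mktuple F) ord_max) tnth_mktuple. Qed.

Lemma ring_pred_atoms : ring_atoms ring_pred_str no_cst ring_pred_set.
Proof.
pose LL := ring_pred_lang.
pose tv k : term LL 3 := TVar LL (inord k).
pose args (j : 'I_2) := if val j == 0%N then tv 1 else tv 2.
split.
- exists 3, (FEq (tv 0%N) (@TFun LL 3 RSub args)), (fun j => inl (val j)) => i rho.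
  by rewrite /= !mktuple_nth0 !mktuple_nth1 /= !tnth_mktuple /= !inordK.
- exists 3, (FEq (tv 0%N) (@TFun LL 3 RMul args)), (fun j => inl (val j)) => i rho.
  by rewrite /= !mktuple_nth0 !mktuple_nth1 /= !tnth_mktuple /= !inordK.
- exists 3, (FEq (tv 0%N) (@TFun LL 3 ROne (fun _ => tv 1%N))), (fun j => inl (val j)).
  by move=> i rho; rewrite /= !tnth_mktuple /= !inordK.
- exists 3, (@FRel LL 3 tt (fun=> tv 0%N)), (fun j => inl (val j)) => i rho.
  by rewrite /= mktuple_nth0 /= !tnth_mktuple /= !inordK.
Qed.

Lemma udef_formula n (P : forall i, (nat -> ring_pred_sort i) -> Prop) :
  udef ring_pred_str no_cst P ->
  exists phi : formula ring_pred_lang n.+1,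
    forall (R : pzRingType) (B : set R) (z : n.+1.-tuple R),
      sat (ring_pred_structure B) z phi <-> P (existT _ R B) (nth (thead z) z).
Proof.
move=> [N [phi [v Hv]]].
(* A variable beyond the arity is sent to variable 0, in agreement with the default [thead z] of
   [nth]. *)
pose s (j : 'I_N) : 'I_n.+1 :=
  match v j with inl k => if (k < n.+1)%N then inord k else ord0 | inr c => of_void _ c end.
exists (formula_ren s phi) => R B z; rewrite sat_ren Hv.
set a := mktuple _; set b := mktuple _; suff -> : a = b by [].
apply: eq_from_tnth => j; rewrite !tnth_mktuple /s.
case: (v j) => [k|[]] /=.
case: ltnP => h; first by rewrite (tnth_nth (thead z)) inordK.
by rewrite nth_default ?size_tuple.
Qed.

End RingPred.

(** * Definability with parameters in the field *)

Section FieldDefinability.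
Variables (K : ovfield) (L : language) (S : structure L K).
Local Notation ES := (expansion S).

(** With a one-point index set and every element of [K] as a constant, [udef] becomes definability
    with parameters in [expansion S]. *)
Definition fld (_ : unit) : pzRingType := K.
Definition fld_str (i : unit) : structure (lang_sum ring_pred_lang L) (fld i) := ES.
Definition fld_cst (i : unit) (c : K) : fld i := c.
Definition fld_set (i : unit) : set (fld i) := ovO K.
Local Notation udef := (udef fld_str fld_cst).

Lemma definable_udef m (D : set (m.-tuple K)) (v : 'I_m -> nat) :
  definable ES D -> udef (fun i rho => D [tuple rho (v j) | j < m]).
Proof.
move=> [r [a [phi ->]]]; exists (m + r)%N, phi,
  (fun j => match fintype.split j with inl k => inl (v k) | inr k => inr (tnth a k) end).
move=> i rho /=; rewrite /fld_str.
set x := tuple _; set y := mktuple _; suff -> : x = y by [].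
apply: eq_from_tnth => j; rewrite tnth_mktuple.
by case: (split_ordP j) => k ->; rewrite ?tnth_lshift ?tnth_rshift ?tnth_mktuple.
Qed.

Lemma udef_definable m (P : forall i, (nat -> fld i) -> Prop) :
  udef P -> definable ES [set z : m.-tuple K | P tt (nth 0 z)].
Proof.
move=> [N [phi [v Hv]]].
(* Each of the [N] slots gets its own parameter: its constant if it has one, otherwise 0, which is
   also what [nth 0 z] returns for variables beyond [m]. *)
exists N, [tuple match v j with inl _ => 0 | inr c => c end | j < N],
  (formula_ren (fun j : 'I_N => match v j with
     | inl k => if insub k is Some k' then lshift N (k' : 'I_m) else rshift m j
     | inr c => rshift m j end) phi).
apply/seteqP; split=> z /=; rewrite sat_ren Hv /fld_str;
  (set a := (X in sat _ X _ -> _); set b := (X in _ -> sat _ X _));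
  (suff -> : a = b by []);
  apply: eq_from_tnth => j; rewrite !tnth_mktuple;
  case Ej: (v j) => [k|c] /=; rewrite ?tnth_rshift ?tnth_mktuple ?Ej //;
  case: insubP => [k' _ <-|]; rewrite ?tnth_lshift ?tnth_rshift ?tnth_mktuple ?Ej //
    -?leqNgt ?(tnth_nth 0) // => h; by rewrite nth_default ?size_tuple.
Qed.

Lemma fld_atoms : ring_atoms fld_str fld_cst fld_set.
Proof.
split.
- have := definable_udef (fun j => match val j with 0 => 1 | 1 => 2 | _ => 0 end)%N
    (definable_sub S).
  by apply: udef_iff => i rho /=; rewrite !tnth_mktuple.
- have := definable_udef (fun j => match val j with 0 => 1 | 1 => 2 | _ => 0 end)%N
    (definable_mul S).
  by apply: udef_iff => i rho /=; rewrite !tnth_mktuple.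
- exact: (udef_fun_cst fld_str fld_cst 1).
- exists 1%N, (@FRel (lang_sum ring_pred_lang L) 1 (inl tt) (fun=> TVar _ ord0)),
    (fun=> inl 0%N) => i rho.
  by rewrite /= mktuple_nth0 /= tnth_mktuple.
Qed.

End FieldDefinability.

(** * Formulas over a ring with a predicate *)

Section RingFormulas.
Variables (R : pzRingType) (B : set R).

Definition vanishes_at (p h : R) : Prop := ~ exists u v, u * p + v * h = 1.

Definition escapes (s w v : R) : Prop :=
  exists c, ~ (exists x y z, x * s + y * w + z * c = 1) /\
    exists x y, x * c + y * v = 1.

(** The single function [e] acts as both radii: where the witness lies, [e] bounds [f / g - h], and
    [e] being nonzero there confines the witness to a neighborhood of [p0] once [e] has small
    support. *)
Definition adherent (p f g s h : R) : Prop :=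
  forall e, ~ vanishes_at p e ->
    exists b, B b /\ escapes s (f - h * g - b * e * g) (e * g).

Definition dominated (p h1 h2 : R) : Prop := exists b, B b /\ vanishes_at p (h1 - b * h2).

Definition codes_finite (p f g s : R) : Prop :=
  exists e c, ~ vanishes_at p e /\ forall h1, adherent p f g s h1 ->
    dominated p h1 c /\ forall h2, adherent p f g s h2 ->
      vanishes_at p (h1 - h2) \/ dominated p e (h1 - h2).

(** Descent by [t] reaches only nonnegative powers, so the last clause accepts [h] or its inverse.
    The value 0 has to be excluded, since it is stable under division by [t]. *)
Definition int_mul (h p t : R) : Prop :=
  exists f g s, codes_finite p f g s /\
    (forall h1, adherent p f g s h1 -> vanishes_at p (h1 - 1) \/
       exists h2, adherent p f g s h2 /\ vanishes_at p (h2 * t - h1)) /\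
    exists h1, adherent p f g s h1 /\ ~ vanishes_at p h1 /\
      (vanishes_at p (h1 - h) \/ vanishes_at p (h1 * h - 1)).

(** The descent now ends at 0, and the clause on [h1 + h] accounts for the negative multiples. *)
Definition int_add (h p t : R) : Prop :=
  exists f g s, codes_finite p f g s /\
    (forall h1, adherent p f g s h1 -> vanishes_at p h1 \/
       exists h2, adherent p f g s h2 /\ vanishes_at p (h2 + t - h1)) /\
    exists h1, adherent p f g s h1 /\
      (vanishes_at p (h1 - h) \/ vanishes_at p (h1 + h)).

End RingFormulas.

Ltac udef_step := cbv beta;
  lazymatch goal with
  | |- udef_fun _ _ _ =>
    first [ eapply udef_fun_var | eapply udef_fun_one | eapply udef_fun_sub
          | eapply udef_fun_add | eapply udef_fun_mul ]
  | |- udef _ _ _ =>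
    first [ eapply udef_not | eapply udef_and | eapply udef_or | eapply udef_all
          | eapply udef_imp | eapply udef_ex | eapply udef_eq | eapply udef_pred ]
  | |- ring_atoms _ _ _ => exact: ring_pred_atoms
  end.

Lemma int_mul_formula n : exists phi : formula ring_pred_lang n.+3,
  forall (R : pzRingType) (B : set R) (z : n.+3.-tuple R),
    sat (ring_pred_structure B) z phi <->
    int_mul B (nth (thead z) z 0) (nth (thead z) z 1) (nth (thead z) z 2).
Proof.
apply: (@udef_formula _ (fun i rho => int_mul (@ring_pred_set i) (rho 0) (rho 1) (rho 2))%N).
rewrite /int_mul /codes_finite /dominated /adherent /escapes /vanishes_at.
repeat udef_step.
Qed.

Lemma int_add_formula n : exists phi : formula ring_pred_lang n.+3,
  forall (R : pzRingType) (B : set R) (z : n.+3.-tuple R),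
    sat (ring_pred_structure B) z phi <->
    int_add B (nth (thead z) z 0) (nth (thead z) z 1) (nth (thead z) z 2).
Proof.
apply: (@udef_formula _ (fun i rho => int_add (@ring_pred_set i) (rho 0) (rho 1) (rho 2))%N).
rewrite /int_add /codes_finite /dominated /adherent /escapes /vanishes_at.
repeat udef_step.
Qed.

(** * Bump functions and common zeros over K *)

Section AbsTheory.
Variable K : ovfield.
Local Notation O := (ovO K).
Implicit Types x y z a b d e u v : K.

Lemma ovON1 : O (-1).
Proof. by case: (ovO_props K) => _ _ /(_ (-1)) + _ _; rewrite invrN1 => -[]. Qed.

Lemma abs_le0x x : abs_le 0 x.
Proof. by exists 0; [exact: ovO0|rewrite mulr0]. Qed.

Lemma abs_leN x y : abs_le x y -> abs_le (- x) y.
Proof. by move=> [a Oa ->]; exists (a * -1); [apply: ovOM ovON1|rewrite mulrN1 mulrN]. Qed.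

Lemma abs_le_x0 x : abs_le x 0 -> x = 0.
Proof. by move=> [a _ ->]; rewrite mul0r. Qed.

Lemma abs_le_neq0 x y : abs_le x y -> x != 0 -> y != 0.
Proof. by move=> xy; apply: contra_neq => y0; apply: abs_le_x0; rewrite -y0. Qed.

Lemma abs_leE y x : x != 0 -> abs_le y x <-> O (y / x).
Proof.
move=> x0; split=> [[a Oa ->]|h]; first by rewrite mulrC mulKf.
by exists (y / x) => //; rewrite mulrC divfK.
Qed.

Lemma abs_leNgt x y : ~ abs_le x y -> abs_le y x.
Proof. by case: (abs_le_total x y). Qed.

Lemma abs_ltE x y : abs_lt x y <-> ~ abs_le y x.
Proof. by split=> [[]//|h]; split=> //; exact: abs_leNgt. Qed.

Lemma abs_le_lt_trans y x z : abs_le x y -> abs_lt y z -> abs_lt x z.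
Proof. by move=> xy /abs_ltE yz; apply/abs_ltE => zx; apply/yz/(abs_le_trans zx). Qed.

Lemma abs_lt_le_trans y x z : abs_lt x y -> abs_le y z -> abs_lt x z.
Proof. by move=> /abs_ltE xy yz; apply/abs_ltE => zx; apply/xy/(abs_le_trans yz). Qed.

Lemma abs_leV x y : x != 0 -> abs_le x y -> abs_le y^-1 x^-1.
Proof.
move=> x0 [a Oa xE]; move: x0; rewrite xE mulf_eq0 negb_or => /andP[y0 a0].
by exists a => //; rewrite invfM mulfVK.
Qed.

Lemma abs_leM_div g x y : g != 0 -> abs_le x (y * g) <-> abs_le (x / g) y.
Proof.
move=> g0; split=> [h|h].
  by have := abs_leM h (abs_lexx g^-1); rewrite mulfK.
by have := abs_leM h (abs_lexx g); rewrite divfK.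
Qed.

Lemma abs_common e e' : e != 0 -> e' != 0 ->
  exists2 d, d != 0 & abs_le d e /\ abs_le d e'.
Proof.
move=> e0 e0'; case: (abs_le_total e e') => h; [exists e|exists e'] => //.
  by split=> //; exact: abs_lexx.
by split=> //; exact: abs_lexx.
Qed.

Lemma abs_ltB_shrink e : e != 0 ->
  exists2 d, d != 0 & forall u v, abs_le u d -> abs_le v d -> abs_lt (u - v) e.
Proof.
move=> /abs_lt_shrink[d /abs_leB_shrink[d' d'0 dB] de].
by exists d' => // u v ud vd; apply/de/dB.
Qed.

Lemma abs_leD_shrink e : e != 0 ->
  exists2 d, d != 0 & forall u v, abs_le u d -> abs_le v d -> abs_le (u + v) e.
Proof.
move=> /abs_leB_shrink[d d0 dB]; exists d => // u v ud vd.
by rewrite -[v]opprK; apply/dB => //; apply: abs_leN.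
Qed.

(** If [y] and [y - e] were both small, their difference [e] would be smaller than itself. *)
Lemma abs_away e : e != 0 ->
  exists2 d, d != 0 & forall y, abs_le (y - e) d -> abs_le d y.
Proof.
move=> e0; have [d d0 dB] := abs_ltB_shrink e0; exists d => // y ye.
case: (abs_le_total d y) => // yd; have := dB _ _ yd ye.
by rewrite opprB addrC subrK => -[_ /(_ (abs_lexx _))].
Qed.

Lemma abs_dist_lt d u v : abs_lt (u - v) d -> abs_lt (v - u) d.
Proof. by move=> uv; apply: (abs_le_lt_trans _ uv); rewrite -opprB; apply/abs_leN/abs_lexx. Qed.

(** Unary operations are treated as binary ones that ignore an argument, so that one composition
    lemma covers both. *)
Definition continuous2_at (op : K -> K -> K) a b : Prop :=
  forall e, e != 0 -> exists2 d, d != 0 & forall u v,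
    abs_le (u - a) d -> abs_le (v - b) d -> abs_le (op u v - op a b) e.

Lemma continuous2_inv a b : a != 0 -> continuous2_at (fun x _ => x^-1) a b.
Proof.
move=> a0 e e0; have [d d0 dP] := abs_away a0.
(* This radius compensates the factors [u^-1] and [a^-1] of the difference of inverses, where [u^-1]
   is at most [d^-1] in size. *)
have ed0 : e * (d * a) != 0 by rewrite !mulf_neq0.
have [d' d'0 [d'd d'e]] := abs_common d0 ed0.
exists d' => // u v ua _; have du := dP _ (abs_le_trans ua d'd).
have u0 := abs_le_neq0 du d0.
have -> : u^-1 - a^-1 = - (u - a) * (u^-1 * a^-1) by field; rewrite a0 u0.
have -> : e = (e * (d * a)) * (d^-1 * a^-1) by field; rewrite a0 d0.
apply: abs_leM; first by apply: abs_leN; exact: abs_le_trans d'e.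
by apply: abs_leM (abs_lexx _); apply: abs_leV.
Qed.

End AbsTheory.

(** * Auxiliary functions on the field, in the ordered and the valued case *)

Section Gadgets.

(** The bare order relation on [K] is packed into a [realFieldType], where the order library and the
    arithmetic tactics apply. *)
Lemma unit_interval_transfer (P : forall K : fieldType, set K -> Prop) :
  (forall R : realFieldType, P R [set x : R | (-1 <= x) && (x <= 1)]) ->
  forall (K : fieldType) (O : set K), unit_interval O -> P K O.
Proof.
(* The field is destructed so that the structure packed below converts to it. *)
move=> HR [T [? ? ? ? ? ? ? ? ? ? ? ? ? ? ?]]; set K := GRing.Field.Pack _.
move=> O [le [[lexx lea let_ ltot] leD leM] ->].
have sub0 x y : le 0 (y - x) = le x y.
  apply/idP/idP => [/leD -/(_ x)|/leD -/(_ (- x))]; first by rewrite add0r subrK.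
  by rewrite subrr.
have add0 x y : le 0 x -> le 0 y -> le 0 (x + y).
  by move=> hx hy; apply: (let_ _ _ _ hy); rewrite -[X in le X _]add0r leD.
have anti0 x : le 0 x -> le x 0 -> x = 0 by move=> h1 h2; apply: lea; rewrite h1 h2.
have le0N x : le 0 (- x) = le x 0 by rewrite -[RHS]sub0 sub0r.
pose nrm (x : K) := if le 0 x then x else - x.
have nrmN x : nrm (- x) = nrm x.
  rewrite /nrm le0N; case: ifP => h1; case: ifP => h2; rewrite ?opprK //.
    by rewrite (anti0 _ h2 h1) oppr0.
  by have := ltot 0 x; rewrite h1 h2.
have le0_norm x : le 0 x -> nrm x = x by rewrite /nrm => ->.
pose mix := Num.IntegralDomain_isLeReal.Build K add0 leM anti0 sub0 (ltot 0) nrmN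
  le0_norm (fun x y => erefl ((y != x) && le x y)).
pose R : realFieldType := HB.pack (GRing.Field.sort K) (GRing.Field.class K) mix.
exact: (HR R).
Qed.

(** A bump for the ordered case: [1 - x * x] vanishes at both ends of the unit interval, so cutting
    it off there is continuous. *)
Definition parabola (K : fieldType) (O : set K) (x : K) : K :=
  if `[<O x>] then 1 - x * x else 0.

(** What the ordered case contributes: sums of two squares detect common zeros, and [parabola] is a
    continuous bump. Continuity is phrased through [O] alone so that the statement can be
    transferred. *)
Definition parabola_props (K : fieldType) (O : set K) : Prop :=
  [/\ forall x y : K, x * x + y * y = 0 -> x = 0 /\ y = 0,
      forall x, O x -> O (1 - x * x) &
      forall a e : K, e != 0 -> exists2 d, d != 0 & forall x,
        O ((x - a) / d) -> O ((parabola O x - parabola O a) / e)].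

Lemma real_parabola_props (R : realFieldType) :
  parabola_props [set x : R | (-1 <= x) && (x <= 1)].
Proof.
split=> /=.
- move=> x y; rewrite -!expr2 => /eqP.
  by rewrite paddr_eq0 ?sqr_ge0 // !sqrf_eq0 => /andP[/eqP -> /eqP ->].
- by move=> x /andP[? ?]; apply/andP; split; nra.
- move=> a e e0.
  have parE x : parabola [set x : R | (-1 <= x) && (x <= 1)] x = Num.max 0 (1 - x * x).
    rewrite /parabola; case: asboolP => /= [/andP[? ?]|].
      by rewrite max_r //; nra.
    move=> /negP; rewrite -ler_norml -ltNge => h; rewrite max_l //.
    have -> : x * x = `|x| * `|x| by rewrite -!expr2 real_normK ?num_real.
    by set y := `|x| in h *; nra.
  (* [D] bounds [|x + a|] as soon as [|x - a| <= 1]; the summand [|e|] makes the radius [|e| / D] at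
     most 1. *)
  pose D := 2 * `|a| + 1 + `|e|.
  have e_gt0 : 0 < `|e| by rewrite normr_gt0.
  have a_ge0 : 0 <= `|a| by [].
  have D0 : 0 < D by rewrite /D; lra.
  have d_gt0 : 0 < `|e| / D by rewrite divr_gt0.
  exists (`|e| / D); first by rewrite gt_eqF.
  move=> x; rewrite -!ler_norml !normrM !normfV ler_pdivrMr ?normr_gt0 ?gt_eqF //.
  rewrite mul1r (ger0_norm (ltW d_gt0)) ler_pdivrMr // mul1r !parE => h.
  have d_le1 : `|e| / D <= 1 by rewrite ler_pdivrMr // mul1r /D; lra.
  have lip (u v : R) : `|Num.max 0 u - Num.max 0 v| <= `|u - v|.
    by rewrite !maxEle; case: (lerP 0 u) => ?; case: (lerP 0 v) => ?; rewrite ler_norml;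
       case: (ger0P (u - v)) => ?; apply/andP; split; lra.
  apply: (le_trans (lip _ _)).
  have -> : 1 - x * x - (1 - a * a) = (a - x) * (x + a) by ring.
  rewrite normrM distrC.
  have h2 : `|x + a| <= D.
    have -> : x + a = (x - a) + a + a by ring.
    rewrite /D; have := ler_normD (x - a + a) a; have := ler_normD (x - a) a; lra.
  have := ler_pM (normr_ge0 _) (normr_ge0 _) h h2.
  by rewrite divfK ?gt_eqF.
Qed.

Lemma valuation_ring_subr (K : fieldType) (O : set K) :
  nontrivial_valuation_ring O -> forall a b, O a -> O b -> O (a - b).
Proof.
move=> [G [le [v [[[lexx lea let_ ltot] leD vM vD] _ ->]]]] a b /= ha hb.
have v1 : v 1 = 0.
  by apply: (addrI (v 1)); rewrite -vM ?oner_neq0 // mulr1 addr0.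
have vN1 : v (-1) = 0.
  have vv : v (-1) + v (-1) = 0 by rewrite -vM ?oppr_eq0 ?oner_neq0 // mulrNN mulr1.
  have := ltot 0 (v (-1)) => /orP[] h; apply: lea; rewrite h ?andbT /=;
    by have := leD _ _ (v (-1)) h; rewrite vv add0r => ->.
have vN x : x != 0 -> v (- x) = v x.
  by move=> x0; rewrite -mulN1r vM ?oppr_eq0 ?oner_neq0 // vN1 add0r.
case: (eqVneq (a - b) 0) => [|ab0]; [by left|right].
case: (eqVneq a 0) ha ab0 => [->|a0].
  rewrite sub0r oppr_eq0 => _ b0; rewrite vN //.
  by case: hb => [/eqP|//]; rewrite (negbTE b0).
case=> [/eqP|ha]; first by rewrite (negbTE a0).
case: (eqVneq b 0) hb => [->|b0]; first by rewrite subr0.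
case=> [/eqP|hb]; first by rewrite (negbTE b0).
have Nb0 : - b != 0 by rewrite oppr_eq0.
by move=> ab0; case/orP: (vD a (- b) a0 Nb0 ab0); rewrite ?vN //; apply: let_.
Qed.

Variables (K : ovfield) (L : language) (S : structure L K).
Local Notation O := (ovO K).
Local Notation udef := (udef (fld_str S) (@fld_cst K)).
Local Notation udef_fun := (udef_fun (fld_str S) (@fld_cst K)).

Lemma udef_abs_le (t u : forall i, (nat -> fld K i) -> fld K i) :
  udef_fun t -> udef_fun u -> udef (fun i rho => abs_le (t i rho : K) (u i rho)).
Proof.
move=> dt du.
have := udef_ex (Q := fun i rho a => fld_set a /\ t i rho = u i rho * a) (udef_and
  (udef_pred (fld_atoms S) (udef_fun_var _ _ 0)) (udef_eq (udef_fun_shift dt)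
  (udef_fun_mul (fld_atoms S) (udef_fun_shift du) (udef_fun_var _ _ 0)))).
by apply: udef_iff => i rho; split=> [[a []]|[a]]; exists a.
Qed.

(** The value is the last variable here, unlike in [udef_fun], to match the form expected by
    [definable_graph_op]. *)
Definition definable_op (op : K -> K -> K) : Prop :=
  udef (fun i rho => rho 2%N = op (rho 0%N) (rho 1%N) :> K).

Lemma definable_op_ite (P : K -> K -> Prop) (op1 op2 : K -> K -> K) :
  udef (fun i rho => P (rho 0%N) (rho 1%N)) ->
  definable_op op1 -> definable_op op2 ->
  definable_op (fun x y => if `[<P x y>] then op1 x y else op2 x y).
Proof.
move=> dP d1 d2.
apply: udef_iff (udef_or (udef_and dP d1) (udef_and (udef_not dP) d2)) => i rho.
by case: asboolP => h; split=> [|->]; by [case=> -[]|left|right].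
Qed.

Lemma ordered_or_ultrametric : parabola_props O \/
  (forall x y e : K, abs_le x e -> abs_le y e -> abs_le (x - y) e).
Proof.
case: (ovOP K) => [/(unit_interval_transfer real_parabola_props)|h]; [by left|right].
move=> x y e [a Oa ->] [b Ob ->]; exists (a - b); last by rewrite mulrBr.
exact: (valuation_ring_subr h).
Qed.

(** In the ordered case [a * a + b * b] has the required zeros. In the valued case a sum of squares
    may cancel, so only the square of the larger of [a] and [b] is kept. *)
Lemma common_zero_gadget : exists al be : K -> K -> K,
  [/\ definable_op al /\ definable_op be,
      forall a b, continuous2_at al a b, forall a b, continuous2_at be a b &
      forall a b, al a b * a + be a b * b = 0 -> a = 0 /\ b = 0].
Proof.
have dfst : definable_op (fun x _ => x).
  exact: (udef_eq (udef_fun_var _ _ 2) (udef_fun_var _ _ 0)).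
have dsnd : definable_op (fun _ y => y).
  exact: (udef_eq (udef_fun_var _ _ 2) (udef_fun_var _ _ 1)).
have d0 : definable_op (fun _ _ => 0).
  exact: (udef_eq (udef_fun_var _ _ 2) (udef_fun_cst _ _ 0)).
case: ordered_or_ultrametric => [[sq0 _ _]|um].
  exists (fun x _ => x), (fun _ y => y); split=> // a b e e0; exists e => //.
exists (fun x y => if `[<abs_le y x>] then x else 0),
  (fun x y => if `[<abs_le y x>] then 0 else y).
have dle := udef_abs_le (udef_fun_var _ _ 1) (udef_fun_var _ _ 0).
have uml (x y e : K) : abs_lt x e -> abs_lt y e -> abs_lt (x - y) e.
  move=> xe ye; case: (abs_le_total x y) => h.
    exact: abs_le_lt_trans (um _ _ _ h (abs_lexx _)) ye.
  exact: abs_le_lt_trans (um _ _ _ (abs_lexx _) h) xe.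
(* By the ultrametric inequality the comparison of the two arguments is locally constant away from
   the origin; at the origin the selected argument tends to 0 anyway. *)
have loc (a b : K) : (a == 0) && (b == 0) \/ exists2 d, d != 0 & forall u v,
    abs_le (u - a) d -> abs_le (v - b) d -> abs_le v u <-> abs_le b a.
  have away (x u d : K) : (forall y, abs_le y d -> abs_lt y x) -> abs_le (u - x) d ->
      abs_le x u.
    move=> dP /dP ux; case: (pselect (abs_le x u)) => // /abs_ltE h.
    by have := uml _ _ _ h ux; rewrite opprB addrC subrK => -[_ /(_ (abs_lexx _))].
  have mv (x y : K) : x = (x - y) - (- y) by rewrite opprK subrK.
  case: (pselect (abs_le b a)) => ba.
    case: (eqVneq a 0) => [a0|a0].
      by left; move: ba; rewrite a0 => /abs_le_x0 ->; rewrite eqxx.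
    right; have [d d0' dP] := abs_lt_shrink a0; exists d => // u v ua vb.
    split=> // _; apply: (abs_le_trans (y := a)); last exact: away _ _ _ dP ua.
    by rewrite (mv v b); apply: um; [case: (dP _ vb)|exact: abs_leN].
  case: (eqVneq b 0) => [b0|b0]; first by case: ba; rewrite b0; exact: abs_le0x.
  right; have [d d0' dP] := abs_lt_shrink b0; exists d => // u v ua vb.
  split=> // vu; case/abs_ltE: ba => _ ba; exfalso.
  have bu := abs_le_trans (away _ _ _ dP vb) vu.
  suff [] : abs_lt u b by [].
  rewrite (mv u a); apply: uml (dP _ ua) _.
  by apply: abs_le_lt_trans (abs_leN (abs_lexx _)) _; apply/abs_ltE.
split; first by split; apply: definable_op_ite.
- move=> a b e e0; case: (loc a b) => [/andP[/eqP-> /eqP->]|[d d0' dP]].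
    exists e => // u v; rewrite subr0 => ue _.
    by rewrite if_same subr0; case: ifP => // _; exact: abs_le0x.
  have [d' d'0 [d'd d'e]] := abs_common d0' e0; exists d' => // u v ua vb.
  rewrite (asbool_equiv_eq (dP _ _ (abs_le_trans ua d'd) (abs_le_trans vb d'd))).
  by case: ifP => _; rewrite ?subrr; [exact: abs_le_trans d'e|exact: abs_le0x].
- move=> a b e e0; case: (loc a b) => [/andP[/eqP-> /eqP->]|[d d0' dP]].
    exists e => // u v _; rewrite subr0 => ve.
    by rewrite if_same subr0; case: ifP => // _; exact: abs_le0x.
  have [d' d'0 [d'd d'e]] := abs_common d0' e0; exists d' => // u v ua vb.
  rewrite (asbool_equiv_eq (dP _ _ (abs_le_trans ua d'd) (abs_le_trans vb d'd))).
  by case: ifP => _; rewrite ?subrr; [exact: abs_le0x|exact: abs_le_trans d'e].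
- move=> a b; case: asboolP => h; rewrite mul0r ?addr0 ?add0r => /eqP;
    rewrite mulf_eq0 orbb => /eqP z0.
    by split=> //; apply: abs_le_x0; rewrite -z0.
  by case: h; rewrite z0; exact: abs_le0x.
Qed.

(** The ordered case uses [parabola]; in the valued case [O] is open and closed, so its indicator
    function is continuous. *)
Lemma bump_gadget : exists ga : K -> K,
  [/\ definable_op (fun x _ => ga x), forall a b, continuous2_at (fun x _ => ga x) a b,
      ga 0 = 1, forall x, O (ga x) & forall x, ga x != 0 -> O x].
Proof.
have dO : udef (fun _ rho => O (rho 0%N)) by exact: (udef_pred (fld_atoms S) (udef_fun_var _ _ 0)).
have d0 : definable_op (fun _ _ => 0).
  exact: (udef_eq (udef_fun_var _ _ 2) (udef_fun_cst _ _ 0)).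
case: ordered_or_ultrametric => [[_ O1x cpar]|um].
  exists (parabola O); split.
  - apply: (definable_op_ite (P := fun x _ => O x) dO _ d0).
    exact: (udef_eq (udef_fun_var _ _ 2) (udef_fun_sub (fld_atoms S) (udef_fun_cst _ _ 1)
      (udef_fun_mul (fld_atoms S) (udef_fun_var _ _ 0) (udef_fun_var _ _ 0)))).
  - move=> a b e e0; have [d d0' dP] := cpar a e e0; exists d => // u v.
    by move=> /abs_leE -/(_ d0') h _; apply/abs_leE => //; exact: dP.
  - by rewrite /parabola asboolT ?mulr0 ?subr0 //; exact: ovO0.
  - by move=> x; rewrite /parabola; case: asboolP => [/O1x|_] //; exact: ovO0.
  - by move=> x; rewrite /parabola; case: asboolP => //; rewrite eqxx.
exists (fun x => if `[<O x>] then 1 else 0); split.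
- apply: (definable_op_ite (P := fun x _ => O x) dO _ d0).
  exact: (udef_eq (udef_fun_var _ _ 2) (udef_fun_cst _ _ 1)).
- move=> a b e e0; exists 1; first exact: oner_neq0.
  move=> u v ua _; suff -> : `[<O u>] = `[<O a>] by rewrite subrr; exact: abs_le0x.
  have OE x : O x <-> abs_le x 1 by rewrite (abs_leE _ (oner_neq0 _)) divr1.
  apply: asbool_equiv_eq; rewrite !OE; split=> h.
    have := um _ _ _ h ua; congr abs_le; ring.
  by have := um _ _ _ ua (abs_leN h); congr abs_le; ring.
- by rewrite asboolT //; exact: ovO0.
- by move=> x; case: asboolP => _; [exact: ovO1|exact: ovO0].
- by move=> x; case: asboolP => //; rewrite eqxx.
Qed.

End Gadgets.

(** * Continuous definable functions *)

Section CdfunTheory.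
Variables (K : ovfield) (L : language) (S : structure L K).
Local Notation O := (ovO K).
Local Notation ES := (expansion S).
Local Notation udef := (udef (fld_str S) (@fld_cst K)).

Lemma definable_op_set (op : K -> K -> K) : definable_op S op ->
  definable ES [set z : 3.-tuple K | tnth z (@Ordinal 3 2 isT) =
    op (tnth z (@Ordinal 3 0 isT)) (tnth z (@Ordinal 3 1 isT))].
Proof.
move=> /(udef_definable 3); congr definable.
by apply/seteqP; split=> z /=; rewrite !(tnth_nth 0).
Qed.

Section AnySet.
Variables (m : nat) (X : set (m.-tuple K)).

Lemma continuous_op (op : K -> K -> K) (f g : X -> K) :
  continuous_fun f -> continuous_fun g ->
  (forall x, continuous2_at op (f x) (g x)) ->
  continuous_fun (fun x => op (f x) (g x)).
Proof.
move=> /continuous_funP fc /continuous_funP gc opc; apply/continuous_funP => x e e0.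
have [d d0 dP] := opc x e e0.
by apply: evly_sub (evly_and (fc x d d0) (gc x d d0)) => y [ha hb]; exact: dP.
Qed.

Lemma continuous_definable_op (op : K -> K -> K) (f g : X -> K) :
  definable_op S op -> continuous_definable S f -> continuous_definable S g ->
  (forall x, continuous2_at op (f x) (g x)) ->
  continuous_definable S (fun x => op (f x) (g x)).
Proof.
move=> dop [fc fd] [gc gd] opc; split; first exact: continuous_op.
exact: (definable_graph_op (definable_op_set dop) fd gd).
Qed.

Lemma continuous_definable_coord (i : 'I_m) : definable ES X ->
  continuous_definable S (fun x : X => tnth (\val x) i).
Proof.
move=> dX; split.
  by apply/continuous_funP => x e e0; exists e => // y yx; case: (yx i).
have := udef_definable (m + 1) (udef_and (definable_udef (fun j => val j) dX)
  (udef_eq (udef_fun_var (fld_str S) (@fld_cst K) m) (udef_fun_var _ _ (val i)))).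
congr definable; apply/seteqP; split=> z /=.
  move=> [Xz zi]; exists (SigSub (mem_set Xz)) => /=.
  apply: eq_from_tnth => j; case: (split_ordP j) => k ->.
    by rewrite tnth_lshift tnth_mktuple (tnth_nth 0).
  rewrite (tnth_rshift _ [tuple _]) ord1 tnth_mktuple -zi (tnth_nth 0) /=.
  by rewrite addn0.
move=> [x ->] /=; rewrite !nth_cat size_tuple ltnn subnn ltn_ord (tnth_nth 0); split=> //.
suff -> : [tuple nth 0 (\val x ++ [:: (\val x)`_i]) j | j < m] = \val x.
  exact: set_mem (valP x).
by apply: eq_from_tnth => j; rewrite tnth_mktuple nth_cat size_tuple ltn_ord (tnth_nth 0).
Qed.

Lemma udef_graph (f : X -> K) (xs : 'I_m -> nat) k : definable ES (graph f) ->
  udef (fun i rho => exists2 y : X, \val y = [tuple rho (xs j) | j < m] & f y = rho k).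
Proof.
pose v (j : 'I_(m + 1)) := match fintype.split j with inl i => xs i | inr _ => k end.
move=> /(definable_udef v); apply: udef_iff => i rho.
have -> : [tuple rho (v j) | j < m + 1] =
    [tuple of [tuple rho (xs j) | j < m] ++ [:: rho k]].
  apply: eq_from_tnth => j; rewrite tnth_mktuple /v.
  case: (split_ordP j) => i' ->; first by rewrite tnth_lshift tnth_mktuple.
  by rewrite (tnth_rshift _ [tuple _]) ord1.
split=> [[y]|[y yE fy]]; last by exists y; rewrite yE fy.
move=> /(congr1 val) /= /eqP; rewrite eqseq_cat ?size_tuple ?card_ord //.
by move=> /andP[/eqP h1 /eqP[h2]]; exists y => //; exact: val_inj.
Qed.

End AnySet.

Variables (m : nat) (X : definable_set S m).
Implicit Types (f g h s w p : cdfun X) (x : X).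

Lemma cdfunP f : continuous_definable S (f : X -> K).
Proof. exact/asboolP/(cdfun_valP f). Qed.

Lemma cdfun_ext f g : (forall x, f x = g x) -> f = g.
Proof. by move=> fg; apply: val_inj; apply: funext. Qed.

Lemma cdfunE : (forall f g x, (f - g) x = f x - g x) * (forall f g x, (f + g) x = f x + g x)
  * (forall f g x, (f * g) x = f x * g x) * (forall x, (0 : cdfun X) x = 0)
  * (forall x, (1 : cdfun X) x = 1) * (forall c x, cdfun_cst X c x = c).
Proof. by []. Qed.

Lemma cdfun_sumE (J : Type) (r : seq J) (F : J -> cdfun X) x :
  (\sum_(j <- r) F j) x = \sum_(j <- r) F j x.
Proof. by elim: r => [|j r IH]; rewrite ?big_nil ?big_cons ?cdfunE ?IH. Qed.

Lemma cdfun_prodE (J : Type) (r : seq J) (F : J -> cdfun X) x :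
  (\prod_(j <- r) F j) x = \prod_(j <- r) F j x.
Proof. by elim: r => [|j r IH]; rewrite ?big_nil ?big_cons ?cdfunE ?IH. Qed.

Lemma cdfun_ex (F : X -> K) : continuous_definable S F ->
  exists f : cdfun X, forall x, f x = F x.
Proof. by move=> /asboolP hF; exists (CDFun hF). Qed.

Lemma cdfun_op (op : K -> K -> K) f g :
  definable_op S op -> (forall x, continuous2_at op (f x) (g x)) ->
  exists k : cdfun X, forall x, k x = op (f x) (g x).
Proof.
by move=> dop opc; apply: cdfun_ex; apply: continuous_definable_op => //; exact: cdfunP.
Qed.

Lemma cdfun_unit f : (forall x, f x != 0) -> exists g, g * f = 1.
Proof.
move=> f0; have [||g gE] := @cdfun_op (fun y _ => y^-1) f f.
(* The graph of inversion must include the convention [0^-1 = 0]. *)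
- apply: udef_iff (udef_or
    (udef_and (udef_eq (udef_fun_var _ _ 0) (udef_fun_cst _ _ 0))
      (udef_eq (udef_fun_var _ _ 2) (udef_fun_cst _ _ 0)))
    (udef_eq (udef_fun_mul (fld_atoms S) (udef_fun_var _ _ 0) (udef_fun_var _ _ 2))
      (udef_fun_cst _ _ 1))) => -[] rho.
  rewrite /fld_cst; split=> [[[-> ->]|]|->]; first by rewrite invr0.
    move=> h; have r0 : rho 0%N != 0 :> K.
      by apply: contra_eq_neq h => ->; rewrite mul0r eq_sym oner_neq0.
    by apply: (mulfI r0); rewrite mulfV.
  by have [->|r0] := eqVneq (rho 0%N : K) 0; [left; rewrite invr0|right; exact: mulfV].
- by move=> x; exact: continuous2_inv.
- by exists g; apply: cdfun_ext => x; rewrite !cdfunE gE; exact: mulVf.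
Qed.

(* A single element of the ideal (f, g) whose zeros are the common zeros of f
   and g; so f and g generate the unit ideal as soon as they have none. *)
Lemma common_zero f g : exists al be : cdfun X,
  forall x, (al * f + be * g) x = 0 -> f x = 0 /\ g x = 0.
Proof.
have [al [be [[dal dbe] cal cbe H]]] := common_zero_gadget S.
have [a aE] := @cdfun_op al f g dal (fun x => cal _ _).
have [b bE] := @cdfun_op be f g dbe (fun x => cbe _ _).
by exists a, b => x; rewrite !cdfunE aE bE; exact: H.
Qed.

End CdfunTheory.

(** * Cluster values *)

Section Semantics.
Variables (K : ovfield) (L : language) (S : structure L K).
Local Notation O := (ovO K).
Local Notation ES := (expansion S).

Lemma oball_sub n (c : n.-tuple K) (d e : K) : abs_le d e -> oball c d `<=` oball c e.
Proof. by move=> de y yd i; exact: abs_lt_le_trans (yd i) de. Qed.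

Variables (m : nat) (X : definable_set S m).
Implicit Types (f g h s w p v : cdfun X) (x : X) (a b c e : K).

Definition unit_ball_functions : set (cdfun X) := [set s : cdfun X | forall x : X, O (s x)].
Local Notation B := unit_ball_functions.

Lemma evly_cdfun h x e : e != 0 -> evly x (fun y => abs_le (h y - h x) e).
Proof. exact: ((continuous_funP (h : X -> K)).1 (cdfunP h).1 x e). Qed.

(** A product of one-variable bumps, one per coordinate: it is nonzero only where every coordinate
    is close to that of [x0]. The scale [d] turns the weak bound from [O] into the strict one of an
    open ball. *)
Lemma cdfun_bump (x0 : X) e : e != 0 -> exists q : cdfun X,
  [/\ q x0 = 1, B q & forall x, q x != 0 -> oball (\val x0) e (\val x)].
Proof.
move=> e0; have [ga [dga cga ga0 gaO gaS]] := bump_gadget S.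
have [d d0 dP] := abs_lt_shrink e0.
have Hq (i : 'I_m) : exists q : cdfun X, forall x,
    q x = ga ((tnth (\val x) i - tnth (\val x0) i) / d).
  have [ci ciE] := cdfun_ex (continuous_definable_coord i (dsetP X)).
  pose y := (ci - cdfun_cst X (tnth (\val x0) i)) * cdfun_cst X d^-1.
  have [q qE] := cdfun_op (f := y) (g := y) dga (fun x => cga _ _).
  by exists q => x; rewrite qE /y !cdfunE ciE.
have /choice[q qE] := Hq.
exists (\prod_(i <- enum 'I_m) q i); split.
- by rewrite cdfun_prodE big1 // => i _; rewrite qE subrr mul0r ga0.
- move=> x /=; rewrite cdfun_prodE; elim/big_rec: _ => [|i y _ Oy]; first exact: ovO1.
  by apply: ovOM Oy; rewrite qE; exact: gaO.
- move=> x; rewrite cdfun_prodE prodf_seq_neq0 => /allP qx i.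
  have := qx i; rewrite mem_enum /= qE => /(_ isT) /gaS h.
  by apply/dP/abs_leE.
Qed.

Lemma escapesP s w v :
  escapes s w v <-> exists x, [/\ s x = 0, w x = 0 & v x != 0].
Proof.
split=> [[c [nc [y [z yz1]]]]|[x [sx wx vx]]].
  (* Two applications of [common_zero] give an element of the ideal of [s], [w] and [c] that
     vanishes only at their common zeros. Without such zeros it would be a unit. *)
  have [a1 [b1 H1]] := common_zero s w.
  have [a2 [b2 H2]] := common_zero (a1 * s + b1 * w) c.
  have [[x x0]|n0] := pselect (exists x, (a2 * (a1 * s + b1 * w) + b2 * c) x = 0).
    have [/H1[sx wx] cx] := H2 _ x0; exists x; split=> //.
    have := congr1 (fun k : cdfun X => k x) yz1; rewrite !cdfunE cx mulr0 add0r.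
    by apply: contra_eq_neq => ->; rewrite mulr0 eq_sym oner_neq0.
  case: nc; have [|k kE] := @cdfun_unit _ _ _ _ _ (a2 * (a1 * s + b1 * w) + b2 * c).
    by move=> x; apply/eqP => h; apply: n0; exists x.
  by exists (k * a2 * a1), (k * a2 * b1), (k * b2); rewrite -kE; ring.
exists (1 - cdfun_cst X (v x)^-1 * v); split.
  move=> [k1 [k2 [k3 /(congr1 (fun k : cdfun X => k x))]]].
  rewrite !cdfunE sx wx mulVf // subrr !mulr0 !addr0 => /eqP.
  by rewrite eq_sym oner_eq0.
by exists 1, (cdfun_cst X (v x)^-1); rewrite mul1r subrK.
Qed.

Variables (p : cdfun X) (p0 : X).
Hypothesis pP : forall x, p x = 0 <-> x = p0.

Lemma vanishes_atP h : vanishes_at p h <-> h p0 = 0.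
Proof.
have p00 : p p0 = 0 by apply/pP.
split=> [nv|h0 [u [v /(congr1 (fun k : cdfun X => k p0))]]].
  have [a [b H]] := common_zero p h.
  have [hp0|/eqP hp0] := eqVneq (h p0) 0; first by [].
  case: nv; have [|k kE] := @cdfun_unit _ _ _ _ _ (a * p + b * h).
    move=> x; apply/eqP => /H[/pP ->]; exact: hp0.
  by exists (k * a), (k * b); rewrite -kE; ring.
by rewrite !cdfunE p00 h0 !mulr0 addr0 => /eqP; rewrite eq_sym oner_eq0.
Qed.

Lemma not_vanishes_atP h : ~ vanishes_at p h <-> h p0 != 0.
Proof. by rewrite vanishes_atP; split=> /eqP. Qed.

Lemma dominatedP h1 h2 : dominated B p h1 h2 <-> abs_le (h1 p0) (h2 p0).
Proof.
split=> [[b [Bb /vanishes_atP]]|[a Oa aE]].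
  rewrite !cdfunE => /eqP; rewrite subr_eq0 => /eqP ->.
  by exists (b p0); [exact: Bb|rewrite mulrC].
exists (cdfun_cst X a); split=> //.
by apply/vanishes_atP; rewrite !cdfunE aE mulrC subrr.
Qed.

(* The cluster points at p0 of f / g along the zeros of s outside those of g. *)
Definition cluster_value f g s a : Prop :=
  forall e, e != 0 -> exists x, [/\ oball (\val p0) e (\val x),
    s x = 0, g x != 0 & abs_le (f x - a * g x) (e * g x)].

(** From left to right the test function is a small constant times a bump at [p0]. From right to
    left an arbitrary [e] is bounded away from 0 near [p0], so a fine enough cluster point meets it.
    In both directions continuity lets [h] be exchanged with its value at [p0] at a small cost. *)
Lemma adherentP f g s h : adherent B p f g s h <-> cluster_value f g s (h p0).
Proof.
split=> [ad e e0|cl e /not_vanishes_atP e0].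
  have [d d0 dP] := abs_leB_shrink e0.
  have [r r0 rP] := evly_cdfun h p0 d0.
  have [e1 e10 [e1r e1d]] := abs_common r0 d0.
  have [e2 e20 [e2e e21]] := abs_common e0 e10.
  have [q [q1 Bq qS]] := cdfun_bump p0 e20.
  have [|b [Bb /escapesP[x [sx wx]]]] := ad (cdfun_cst X e2 * q).
    by apply/not_vanishes_atP; rewrite !cdfunE q1 mulr1.
  rewrite !cdfunE !mulf_eq0 !negb_or -andbA => /and3P[_ qx gx].
  have xb := qS _ qx; exists x; split=> //; first exact: oball_sub e2e _ xb.
  have hx : abs_le (h x - h p0) d by apply/rP/(oball_sub _ xb)/(abs_le_trans e21).
  apply/abs_leM_div => //.
  have -> : (f x - h p0 * g x) / g x = b x * e2 * q x - - (h x - h p0).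
    move: wx; rewrite !cdfunE => /eqP; rewrite subr_eq0 => /eqP wx.
    have -> : f x = h x * g x + b x * (e2 * q x) * g x by rewrite -wx; ring.
    by field.
  apply: dP; last exact: abs_leN.
  apply: abs_le_trans (abs_le_trans e21 e1d).
  by exists (b x * q x); [exact: ovOM|ring].
have [d d0 dP] := abs_away e0.
have [r r0 rP] := evly_cdfun e p0 d0.
have [d1 d10 d1P] := abs_leB_shrink d0.
have [r' r'0 r'P] := evly_cdfun h p0 d10.
have [e1 e10 [e1r e1r']] := abs_common r0 r'0.
have [e2 e20 [e21 e2d]] := abs_common e10 d10.
have [x [xb sx gx fx]] := cl e2 e20.
have dx : abs_le d (e x).
  by apply/dP/rP/(oball_sub _ xb)/(abs_le_trans e21).
have hx : abs_le (h x - h p0) d1 by apply/r'P/(oball_sub _ xb)/(abs_le_trans e21).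
have ex := abs_le_neq0 dx d0.
(* The equation has to hold at the one witness [x] only, so a constant function suffices for [b]. *)
exists (cdfun_cst X ((f x - h x * g x) / (e x * g x))); split; last first.
  apply/escapesP; exists x; rewrite !cdfunE mulf_neq0 //; split=> //.
  by field; rewrite gx ex.
move=> _ /=; have : abs_le ((f x - h p0 * g x) / g x - (h x - h p0)) d.
  apply: d1P => //; apply: abs_le_trans e2d; exact/abs_leM_div.
move=> /abs_le_trans -/(_ _ dx) /(abs_leE _ ex); congr O; field.
by rewrite gx ex.
Qed.

(** The definition is rewritten over [K]: the values of [f], [g] and [s] become quantified variables
    tied to the point by the three graphs. *)
Lemma definable_cluster_value f g s :
  definable ES [set z : 1.-tuple K | cluster_value f g s (tnth z ord0)].
Proof.
have FS : ring_atoms (fld_str S) (@fld_cst K) (@fld_set K) := fld_atoms S.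
pose Q (i : unit) (rho : nat -> fld K i) (x : m.-tuple (fld K i)) : Prop :=
  (* rho 0, 1, 2, 3, 4 = f x, g x, s x, epsilon, a *)
  ((exists2 y : X, \val y = x & f y = rho 0%N) /\
   (exists2 y : X, \val y = x & g y = rho 1%N) /\
   (exists2 y : X, \val y = x & s y = rho 2%N)) /\
  (forall i, abs_lt (tnth x i - tnth (\val p0) i : K) (rho 3%N)) /\
  rho 2%N = 0 /\ ~ (rho 1%N = 0) /\
  abs_le (rho 0%N - rho 4%N * rho 1%N : K) (rho 3%N * rho 1%N : K).
have dQ : udef (fld_str S) (@fld_cst K) (fun i rho => exists x : m.-tuple (fld K i), Q i rho x).
  apply: (udef_extuple (Q := Q)); rewrite /Q.
  apply: udef_and; last apply: udef_and; last apply: udef_and; last apply: udef_and.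
  - have dg (h : cdfun X) k := udef_graph (@nat_of_ord m) (m + k)%N (cdfunP h).2.
    exact: (udef_and (dg f 0%N) (udef_and (dg g 1%N) (dg s 2%N))).
  - apply: udef_allI => j.
    have dt := udef_fun_sub FS (udef_fun_var _ _ (val j)) (udef_fun_cst _ _ (tnth (\val p0) j)).
    have du := udef_fun_var (fld_str S) (@fld_cst K) (m + 3).
    apply: udef_iff (udef_not (udef_abs_le du dt)) => -[] rho.
    by rewrite abs_ltE tnth_mktuple.
  - exact: udef_eq (udef_fun_var _ _ _) (udef_fun_cst _ _ 0).
  - exact: udef_not (udef_eq (udef_fun_var _ _ _) (udef_fun_cst _ _ 0)).
  - apply: (@udef_abs_le _ _ _ (fun i rho => rho (m + 0)%N - rho (m + 4)%N * rho (m + 1)%N)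
      (fun i rho => rho (m + 3)%N * rho (m + 1)%N)).
      exact: (udef_fun_sub FS (udef_fun_var _ _ _) (udef_fun_mul FS (udef_fun_var _ _ _)
        (udef_fun_var _ _ _))).
    exact: (udef_fun_mul FS (udef_fun_var _ _ (m + 3)) (udef_fun_var _ _ (m + 1))).
pose R (i : unit) (rho : nat -> fld K i) : Prop :=
  forall e : fld K i, ~ (e = 0) -> exists vs vg vf : fld K i, exists x : m.-tuple (fld K i),
   Q i (fun n => match n with 0 => vf | 1 => vg | 2 => vs | 3 => e | k.+4 => rho k end%N) x.
have dR : udef (fld_str S) (@fld_cst K) R.
  apply: udef_all; apply: udef_imp.
    exact: udef_not (udef_eq (udef_fun_var _ _ _) (udef_fun_cst _ _ 0)).
  do 3 apply: udef_ex.
  have dQ' := udef_ren id dQ.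
  apply: udef_iff dQ' => i rho.
  suff -> : (fun n => rho (id n)) = (fun n => match n with 0 => rho 0 | 1 => rho 1
     | 2 => rho 2 | 3 => rho 3 | k.+4 => rho k.+4 end%N) by [].
  by apply: funext => -[|[|[|[]]]].
have := udef_definable 1 dR; congr definable; apply/seteqP; split=> z /=.
  move=> Hz e /eqP e0; have [vs [vg [vf [x]]]] := Hz e e0.
  move=> [[[y xy /= <-] [[y' xy' <-] [y'' xy'' <-]]] [xe [sy [/eqP gy fy]]]].
  have E1 : y' = y by apply: val_inj; exact: etrans xy' (esym xy).
  have E2 : y'' = y by apply: val_inj; exact: etrans xy'' (esym xy).
  move: sy gy fy; rewrite E1 E2 => sy gy fy.
  exists y; split=> //; first by move=> i; rewrite xy; exact: xe.
  by rewrite (tnth_nth 0).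
move=> Hz e /eqP e0; have [x [xe sx gx fx]] := Hz e e0.
exists (s x), (g x), (f x), (\val x); split; first by split; [|split]; exists x.
do 3 (split=> //); first exact/eqP.
by rewrite -(tnth_nth 0 z ord0).
Qed.

Definition separated_values (A : K -> Prop) : Prop :=
  exists e c, e != 0 /\ forall a, A a ->
    abs_le a c /\ forall b, A b -> a = b \/ abs_le e (a - b).

Lemma codes_finiteP f g s :
  codes_finite B p f g s <-> separated_values (cluster_value f g s).
Proof.
split=> [[e [c [/not_vanishes_atP e0 H]]]|[e [c [e0 H]]]].
  exists (e p0), (c p0); split=> // a Aa.
  have [|/dominatedP ac Ha] := H (cdfun_cst X a); first exact/adherentP.
  split=> // b Ab; have [||] := Ha (cdfun_cst X b); first exact/adherentP.
    by move=> /vanishes_atP; rewrite !cdfunE => /eqP; rewrite subr_eq0 => /eqP; left.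
  by move=> /dominatedP; right.
exists (cdfun_cst X e), (cdfun_cst X c); split; first exact/not_vanishes_atP.
move=> h1 /adherentP /H[h1c H1]; split; first exact/dominatedP.
move=> h2 /adherentP /H1[h12|h12]; [left|right]; last exact/dominatedP.
by apply/vanishes_atP; rewrite !cdfunE h12 subrr.
Qed.

End Semantics.

(** A uniform gap makes the set closed and discrete, so the hypothesis on [K] applies to it. *)
Lemma separated_finite (K : ovfield) (L : language) (S : structure L K)
    (finK : forall D : set (1.-tuple K), definable (expansion S) D ->
      closed_set D -> bounded_set D -> discrete_set D -> finite_set D)
    (A : K -> Prop) :
  definable (expansion S) [set z : 1.-tuple K | A (tnth z ord0)] ->
  separated_values A -> exists l : seq K, forall a, A a -> a \in l.
Proof.
move=> dA [e [c [e0 H]]].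
have : finite_set [set z : 1.-tuple K | A (tnth z ord0)].
  apply: finK => //.
  - move=> x nAx; have [d d0 dP] := abs_ltB_shrink e0.
    have [[a Aa ax]|na] := pselect (exists2 a, A a & abs_lt (a - tnth x ord0) d).
      (* The open ball with radius the distance to [a] omits [a], and the gap leaves no room in it
         for a second element. *)
      exists (a - tnth x ord0).
        by apply/eqP => /eqP; rewrite subr_eq0 => /eqP aE; apply: nAx; rewrite /= -aE.
      move=> y /= yx Ay; have := yx ord0.
      have [_ /(_ _ Ay)[->|]] := H _ Aa; first by case=> _; apply; exact: abs_lexx.
      move=> eay _; have [ay _] := yx ord0; have [ax' _] := ax.
      have [_] := dP _ _ ax' (abs_le_trans ay ax'); apply.
      by move: eay; congr abs_le; ring.
    by exists d => // y yx Ay; apply: na; exists (tnth y ord0).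
  - by exists c => z /H[zc _] i; rewrite ord1.
  - move=> x Ax; split=> //; exists e => // y [Ay yx] /=.
    have [_ /(_ _ Ax)[xy|h]] := H _ Ay; last by case: (yx ord0).
    by apply: eq_from_tnth => i; rewrite ord1.
move=> /finite_seqP[l lE]; exists [seq tnth z ord0 | z : 1.-tuple K <- l] => a Aa.
apply/mapP; exists [tuple a]; last by rewrite (tnth_nth 0).
by have : [set` l] [tuple a] by rewrite -lE /= (tnth_nth 0).
Qed.

(** * Finite sets, sums and products, balls *)

Section FiniteBounds.
Variable K : ovfield.
Implicit Types (l : seq K) (x : K).

Lemma abs_lower_bound l : exists2 e : K, e != 0 &
  forall x, x \in l -> x != 0 -> abs_lt e x.
Proof.
elim: l => [|y l [e e0 He]]; first by exists 1 => //; exact: oner_neq0.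
have [->|y0] := eqVneq y 0.
  exists e => // x; rewrite inE => /predU1P[->|]; last exact: He.
  by rewrite eqxx.
have [d d0 dy] := abs_lt_shrink y0; have [e' e'0 [e'd e'e]] := abs_common d0 e0.
exists e' => // x; rewrite inE => /predU1P[->|xl] x0; first exact: dy.
exact: abs_le_lt_trans e'e (He _ xl x0).
Qed.

Lemma abs_upper_bound l : exists c : K, forall x, x \in l -> abs_le x c.
Proof.
elim: l => [|y l [c Hc]]; first by exists 0.
have [yc|cy] := abs_le_total y c; [exists c|exists y] => x;
  rewrite inE => /predU1P[->|/Hc] //; first exact: abs_lexx.
by move=> xc; exact: abs_le_trans cy.
Qed.

Lemma finite_separated l (A : K -> Prop) :
  (forall a, A a -> a \in l) -> separated_values A.
Proof.
move=> Al; have [e e0 He] := abs_lower_bound [seq a - b | a <- l, b <- l].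
have [c Hc] := abs_upper_bound l; exists e, c; split=> // a /Al al.
split; first exact: Hc.
move=> b /Al bl; have [->|ab] := eqVneq a b; [by left|right].
suff [] : abs_lt e (a - b) by [].
by apply: He; rewrite ?subr_eq0 //; apply/allpairsP; exists (a, b).
Qed.

(** [O] need not be closed under addition; scaling by [M / d] reduces to two summands so small that
    their sum lies in [O]. *)
Lemma abs_leD_bound (r1 r2 : K) : exists r,
  forall u v, abs_le u r1 -> abs_le v r2 -> abs_le (u + v) r.
Proof.
have [M M0 [h1 h2]] : exists2 M : K, M != 0 & abs_le r1 M /\ abs_le r2 M.
  have [c Hc] := abs_upper_bound [:: 1; r1; r2].
  exists c; first by apply: abs_le_neq0 (Hc 1 _) (oner_neq0 _); rewrite inE eqxx.
  by split; apply: Hc; rewrite !inE eqxx ?orbT.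
have [d d0 dP] := abs_leD_shrink (oner_neq0 K).
exists (M / d) => u v ur vr; have Md0 : M / d != 0 by rewrite mulf_neq0 ?invr_eq0.
have scal w : abs_le w M -> abs_le (w / (M / d)) d.
  by move=> wM; apply/abs_leM_div => //; rewrite mulrC divfK.
have := dP _ _ (scal _ (abs_le_trans ur h1)) (scal _ (abs_le_trans vr h2)).
by rewrite -mulrDl => /(abs_leM_div _ _ Md0); rewrite mul1r.
Qed.

Lemma continuous2_mul (a b : K) : continuous2_at (fun x y => x * y) a b.
Proof.
move=> e e0; have [d d0 dP] := abs_leD_shrink e0.
have [d' d'0 d'P] := abs_leD_shrink d0.
have [d1 d10 d1P] := abs_leM_shrink a d0.
have [d2 d20 d2P] := abs_leM_shrink b d'0.
have [d3 d30 [d31 d32]] := abs_common d10 d20.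
have [d4 d40 [d43 d4d]] := abs_common d30 d'0.
have [d5 d50 [d54 d51]] := abs_common d40 (oner_neq0 K).
exists d5 => // u v ua vb.
have -> : u * v - a * b = (b * (u - a) + (u - a) * (v - b)) + a * (v - b) by ring.
apply: dP; last by apply: d1P; exact: abs_le_trans (abs_le_trans vb d54) (abs_le_trans d43 d31).
apply: d'P; first by apply: d2P; exact: abs_le_trans (abs_le_trans ua d54) (abs_le_trans d43 d32).
rewrite -[d']mulr1; apply: abs_leM; last exact: abs_le_trans vb d51.
exact: abs_le_trans (abs_le_trans ua d54) d4d.
Qed.

Lemma oball_trans n (e : K) : e != 0 -> exists2 d, d != 0 &
  forall x y z : n.-tuple K, oball x d y -> oball y d z -> oball x e z.
Proof.
move=> e0; have [d d0 dP] := abs_ltB_shrink e0; exists d => // x y z xy yz i.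
have -> : tnth z i - tnth x i = (tnth z i - tnth y i) - - (tnth y i - tnth x i) by ring.
by apply: dP; [case: (yz i)|apply: abs_leN; case: (xy i)].
Qed.

Lemma oball_sym n (d : K) (x y : n.-tuple K) : oball x d y -> oball y d x.
Proof. by move=> xy i; apply: abs_dist_lt. Qed.

Lemma oball_center n (d : K) (x : n.-tuple K) : d != 0 -> oball x d x.
Proof.
move=> d0 i; rewrite subrr; apply/abs_ltE => /abs_le_x0 /eqP.
by rewrite (negbTE d0).
Qed.

Lemma oball_avoid n (x y : n.-tuple K) : x != y -> exists2 d, d != 0 & ~ oball x d y.
Proof.
move=> xy; have [i xyi] : exists i, tnth x i != tnth y i.
  apply: contrapT => h; case/eqP: xy; apply: eq_from_tnth => i.
  by apply/eqP; apply: contrapT => /negP h'; apply: h; exists i.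
exists (tnth y i - tnth x i); first by rewrite subr_eq0 eq_sym.
by move=> /(_ i)[_]; apply; exact: abs_lexx.
Qed.

End FiniteBounds.

(** * Extending a function by zero after multiplication *)

Section ExtensionByZero.
Variables (K : ovfield) (L : language) (S : structure L K) (m : nat).
Local Notation ES := (expansion S).
Variables (X V : definable_set S m).

Definition ext0 (psi : V -> K) (x : m.-tuple K) : K :=
  if pselect ((V : set _) x) is left h then psi (SigSub (mem_set h)) else 0.

Lemma ext0_val psi (y : V) : ext0 psi (\val y) = psi y.
Proof.
rewrite /ext0; case: pselect => [h|[]]; last exact: set_mem (valP y).
by congr psi; apply: val_inj.
Qed.

Lemma ext0_out psi x : ~ (V : set _) x -> ext0 psi x = 0.
Proof. by rewrite /ext0; case: pselect. Qed.

Lemma evly_center (x : X) P : evly x P -> P x.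
Proof. by move=> [d d0]; apply; exact: oball_center. Qed.

(** The alternatives are three reasons for continuity at [x]: the product is locally one of
    continuous functions, it is locally zero, or a factor tending to 0 meets a bounded one. The last
    serves at [p0], to which the functions [delta] need not extend. *)
Lemma extend_by_zero (G : cdfun X) (psi : cdfun V) :
  (forall x : X, [\/ evly x (fun y => (V : set _) (\val y)),
     evly x (fun y => G y = 0) |
     G x = 0 /\ exists r, evly x (fun y => abs_le (ext0 psi (\val y)) r)]) ->
  exists F : cdfun X, forall x, F x = G x * ext0 psi (\val x).
Proof.
move=> H; apply: cdfun_ex; split.
  apply/continuous_funP => x e e0; case: (H x) => [Vx|Gx|[Gx [r psir]]].
  - have Vxx := evly_center Vx; pose x' : V := SigSub (mem_set Vxx).
    have [d d0 dP] := continuous2_mul (G x) (psi x') e0.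
    have [d' d'0 d'P] := evly_cdfun psi x' d0.
    have psic : evly x (fun y => abs_le (ext0 psi (\val y) - psi x') d).
      have near_x : evly x (fun y => oball (\val x) d' (\val y)) by exists d'.
      apply: evly_sub (evly_and Vx near_x) => y [Vy yx].
      have := d'P (SigSub (mem_set Vy)) yx; congr abs_le; congr (_ - _).
      by rewrite -ext0_val.
    apply: evly_sub (evly_and (evly_cdfun G x d0) psic) => y [h1 h2].
    by rewrite (ext0_val psi x'); exact: dP.
  - have Gx0 := evly_center Gx; apply: evly_sub Gx => y; rewrite Gx0 => ->.
    by rewrite !mul0r subrr; exact: abs_le0x.
  - have [d d0 dP] := abs_leM_shrink r e0.
    apply: evly_sub (evly_and (evly_cdfun G x d0) psir) => y [].
    rewrite Gx mul0r !subr0 => h1 h2.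
    apply: abs_le_trans (dP _ (abs_lexx _)).
    by rewrite mulrC; exact: abs_leM.
have FS := fld_atoms S.
pose P (i : unit) (rho : nat -> fld K i) (u : fld K i) : Prop :=
  (exists2 y : X, \val y = [tuple rho (val j) | j < m] & G y = u) /\
  ((exists w : fld K i, (exists2 y : V, \val y = [tuple rho (val j) | j < m] & psi y = w)
     /\ rho m = u * w) \/
   (~ (V : set _) [tuple rho (val j) | j < m] /\ rho m = 0)).
have dP : udef (fld_str S) (@fld_cst K) (fun i rho => exists u, P i rho u).
  apply: udef_ex; apply: udef_and.
    exact: (udef_graph (fun j => (val j).+1) 0 (cdfunP G).2).
  apply: udef_or.
    apply: (udef_ex (Q := fun i (rho : nat -> fld K i) w =>
      (exists2 y : V, \val y = [tuple rho (val j).+1 | j < m] & psi y = w)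
      /\ rho m.+1 = rho 0%N * w)).
    apply: udef_and; first exact: (udef_graph (fun j => (val j).+2) 0 (cdfunP psi).2).
    exact: (udef_eq (udef_fun_var _ _ m.+2) (udef_fun_mul FS (udef_fun_var _ _ 1)
      (udef_fun_var _ _ 0))).
  apply: udef_and.
    exact: (udef_not (definable_udef (fun j => (val j).+1) (dsetP V))).
  exact: (udef_eq (udef_fun_var _ _ m.+1) (udef_fun_cst _ _ 0)).
have := udef_definable (m + 1) dP; congr definable; apply/seteqP; split=> z /=.
  rewrite /P; set x := mktuple _; move=> [u [[y yx <-] Hz]].
  have zE : z = [tuple of \val y ++ [:: z`_m]].
    apply: eq_from_tnth => j; case: (split_ordP j) => i ->.
      by rewrite tnth_lshift yx tnth_mktuple (tnth_nth 0).
    by rewrite (tnth_rshift _ [tuple z`_m]) ord1 !(tnth_nth 0) /= addn0.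
  exists y; rewrite [LHS]zE; suff -> : z`_m = G y * ext0 psi (\val y) by [].
  case: Hz => [[w [[y' y'x <-] ->]]|[nV ->]].
    by rewrite yx -y'x ext0_val.
  by rewrite yx ext0_out // mulr0.
move=> [x ->]; exists (G x).
rewrite /P; set t := mktuple _; have -> : t = \val x.
  by apply: eq_from_tnth => j; rewrite tnth_mktuple nth_cat size_tuple ltn_ord (tnth_nth 0).
rewrite nth_cat size_tuple ltnn subnn /=.
split; first by exists x.
have [Vx|nVx] := pselect ((V : set _) (\val x)); last by right; rewrite ext0_out ?mulr0.
left; exists (psi (SigSub (mem_set Vx))); split; first by eexists; last reflexivity.
by congr (_ * _); rewrite -ext0_val.
Qed.

End ExtensionByZero.

(** * Realization of finite sets *)

Lemma bounded_sum (K : ovfield) (T J : Type) (r : seq J) (F : J -> T -> K) :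
  (forall j, exists b, forall x, abs_le (F j x) b) ->
  exists b, forall x, abs_le (\sum_(j <- r) F j x) b.
Proof.
move=> Fb; elim: r => [|j r [b2 IH]].
  by exists 0 => x; rewrite big_nil; exact: abs_lexx.
have [b1 H1] := Fb j; have [b bP] := abs_leD_bound b1 b2.
by exists b => x; rewrite big_cons; exact: bP.
Qed.

Section Realization.
Variables (K : ovfield) (L : language) (S : structure L K) (m : nat).
Local Notation ES := (expansion S).
Variables (X : definable_set S m) (p : cdfun X) (p0 : X).
Hypothesis pP : forall x : X, p x = 0 <-> x = p0.

(* At least two germs: (S3) does not constrain a single delta. *)
Lemma realize_cluster_values k (a : 'I_k -> K) : (1 < k)%N ->
  arbitrarily_many_germs S X (\val p0) ->
  exists f g s : cdfun X, forall c, cluster_value p0 f g s c <-> exists i, c = a i.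
Proof.
move=> k1 /(_ k (ltnW k1)) [U [sf [dU [UX Up0 [r r0 Ur]] sfc]]].
move=> [delta [deltac [_ S2 S3 S4]]].
pose U' : definable_set S m := DefinableSet dU.
have dV : definable ES (U `\ \val p0).
  have FS := fld_atoms S.
  have := udef_definable m (udef_and (definable_udef (fun j => val j) dU)
    (udef_not (udef_allI (fun i : 'I_m => udef_eq
      (udef_fun_var (fld_str S) (@fld_cst K) (val i))
      (udef_fun_cst _ _ (tnth (\val p0) i)))))).
  have zE (z : m.-tuple K) : [tuple nth 0 z j | j < m] = z.
    by apply: eq_from_tnth => j; rewrite tnth_mktuple (tnth_nth 0).
  congr definable; apply/seteqP; split=> z /=; rewrite zE => -[Uz zp]; split=> //.
    by move=> zp0; apply: zp => i; rewrite zp0 (tnth_nth 0).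
  move=> zi; apply: zp; apply: eq_from_tnth => i.
  by rewrite (tnth_nth 0); exact: zi.
pose V' : definable_set S m := DefinableSet dV.
have /choice[sU sUE] : forall i, exists s : cdfun U', forall y, s y = sf i y.
  by move=> i; exact: (@cdfun_ex _ _ _ _ U' (sf i) (sfc i)).
have /choice[dl dlE] : forall i, exists s : cdfun V', forall y, s y = delta i y.
  by move=> i; exact: (@cdfun_ex _ _ _ _ V' (delta i) (deltac i)).
(* Nested radii: a point in the [r1]-ball about [p0] has its own [r1]-ball in [U], and any other
   point has an [r2]-ball on which [q] vanishes. *)
have [r1 r10 r1P] := oball_trans m r0.
have [r2 r20 r2P] := oball_trans m r10.
have [q [q1 _ qS]] := cdfun_bump p0 r20.
have far (x : X) : ~ oball (\val p0) r1 (\val x) -> evly x (fun y => q y = 0).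
  move=> xp; exists r2 => // y xy; apply/eqP; case: eqVneq => // /qS py; case: xp.
  exact: r2P py (oball_sym xy).
have near_p0 (x : X) : oball (\val p0) r1 (\val x) -> evly x (fun y => U (\val y)).
  move=> px; exists r1 => // y xy; apply: Ur; split; first exact: set_mem (valP y).
  exact: r1P px xy.
have qU (x : X) : q x != 0 -> U (\val x).
  move=> qx; have [/near_p0 Ux|/far qx0] := pselect (oball (\val p0) r1 (\val x)).
    exact: (evly_center Ux).
  by move: qx; rewrite (evly_center qx0) eqxx.
have p00 : p p0 = 0 by apply/pP.
pose phi : cdfun V' := \sum_(i < k) cdfun_cst V' (a i) * dl i.
(* The additional zeros of [s] where [q] vanishes do no harm, because [q * p] vanishes there too. *)
have [s sE] : exists s : cdfun X, forall x,
    s x = q x * ext0 (V := U') (\prod_(i < k) sU i) (\val x).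
  apply: extend_by_zero => x.
  have [/near_p0 Ux|/far qx0] := pselect (oball (\val p0) r1 (\val x)).
    exact: Or31.
  exact: Or32.
have [f fE] : exists f : cdfun X, forall x, f x = (q * p) x * ext0 (V := V') phi (\val x).
  apply: extend_by_zero => x.
  have [xp|xp] := eqVneq x p0.
    (* At [p0] the factor [p] vanishes, and (S4) bounds the combination of the [delta]s. *)
    apply: Or33; rewrite xp !cdfunE p00 mulr0; split=> //.
    have [|b bP] := @bounded_sum K V' 'I_k (index_enum 'I_k) (fun i y => a i * dl i y).
      move=> i; have [b bP] := S4 i; exists (a i * b) => y.
      by rewrite dlE; apply: abs_leM (abs_lexx _) (bP y).
    exists b, 1 => [|y _]; first exact: oner_neq0.
    rewrite /ext0; case: pselect => [h|_]; last exact: abs_le0x.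
    rewrite cdfun_sumE; have := bP (SigSub (mem_set h)).
    by congr abs_le; apply: eq_bigr => i _; rewrite cdfunE.
  have [/near_p0 Ux|/far qx0] := pselect (oball (\val p0) r1 (\val x)).
    apply: Or31; have [|d d0 dx] := @oball_avoid K m (\val x) (\val p0).
      by apply: contra_neq xp => /val_inj.
    have near_x : evly x (fun y => oball (\val x) d (\val y)) by exists d.
    apply: evly_sub (evly_and Ux near_x) => y [Uy xy]; split=> // yp.
    by apply: dx; rewrite -yp.
  by apply: Or32; apply: evly_sub qx0 => y qy; rewrite cdfunE qy mul0r.
(* On the zeros of the germ [i], (S3) leaves the single term [a i] of the sum. *)
have fa (x : X) i : x != p0 -> zero_set (sf i) (\val x) -> f x = (q * p) x * a i.
  move=> xp zx; have [y yx sy] := zx.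
  have Vx : (U `\ \val p0) (\val x).
    split; first by rewrite -yx; exact: set_mem (valP y).
    by move=> /val_inj; apply/eqP.
  pose x' : V' := SigSub (mem_set Vx).
  rewrite fE; congr (_ * _); rewrite (ext0_val phi x') cdfun_sumE.
  rewrite (bigD1 i) // big1 => [|j ji].
    have [j ij] : exists j : 'I_k, i != j.
      have [i0|i0] := eqVneq (val i) 0%N; [exists (Ordinal k1)|exists (Ordinal (ltnW k1))];
        by rewrite -val_eqE /= ?i0.
    by rewrite [LHS]addr0 cdfunE dlE (S3 i j ij x').1 // mulr1.
  by rewrite cdfunE dlE (S3 j i ji x').2 // mulr0.
exists f, (q * p), s => c; split.
  move=> cl; apply: contrapT => nc.
  (* Where [s] vanishes and [q * p] does not, the quotient takes only the values [a i]; [e] is below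
     all their nonzero distances to [c]. *)
  have [e e0 He] := abs_lower_bound [seq a i - c | i : 'I_k].
  have [x [_ sx gx fx]] := cl e e0.
  move: gx; rewrite cdfunE mulf_eq0 negb_or => /andP[qx px].
  have xp : x != p0 by apply: contra_neq px => /pP.
  pose x' : U' := SigSub (mem_set (qU x qx)).
  have /eqP : s x = 0 by [].
  rewrite sE mulf_eq0 (negbTE qx) /= (ext0_val _ x') cdfun_prodE prodf_seq_eq0.
  move=> /hasP[i _ /= /eqP]; rewrite sUE => sx'.
  have fxE : f x = (q * p) x * a i by apply: fa => //; exists x'.
  have ac : a i - c != 0.
    by apply/eqP => /eqP; rewrite subr_eq0 => /eqP ac; apply: nc; exists i.
  have [|_ /(_ _)] := He (a i - c) _ ac; first by apply: (map_f (fun i => a i - c)); rewrite mem_enum.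
  apply; move: fx; rewrite fxE.
  have -> : (q * p) x * a i - c * (q * p) x = (a i - c) * (q * p) x by ring.
  rewrite abs_leM_div ?mulfK //; rewrite cdfunE mulf_neq0 //.
move=> [i ->] e e0; have [_ iso] := S2 i.
(* Since [q] is 1 at [p0], it is nonzero nearby, where non-isolation supplies zeros of the germ
   [i]. *)
have [d d0 dP] := abs_away (oner_neq0 K).
have [r3 r30 r3P] := evly_cdfun q p0 d0.
have [r4 r40 [r4e r43]] := abs_common e0 r30.
have [x zx [xp xb]] : exists2 x, zero_set (sf i) x & x <> \val p0 /\ oball (\val p0) r4 x.
  apply: contrapT => nx; apply: iso; split; first by case: (S2 i).
  exists r4 => // y [zy yb]; apply: contrapT => yp; apply: nx; exists y => //.
have [y yx sy] := zx.
have Xx : (X : set _) x by apply: UX; rewrite -yx; exact: set_mem (valP y).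
pose x' : X := SigSub (mem_set Xx).
have xp' : x' != p0 by apply/eqP => xp'; apply: xp; rewrite -xp'.
have qx : q x' != 0.
  by apply: abs_le_neq0 d0; apply: dP; rewrite -q1; apply: r3P; exact: oball_sub r43 _ xb.
exists x'; split.
- exact: oball_sub r4e _ xb.
- have -> : s x' = q x' * ext0 (V := U') (\prod_(i < k) sU i) (\val y) by rewrite sE yx.
  rewrite (ext0_val _ (y : U')) cdfun_prodE (bigD1 i) //=.
  by rewrite sUE sy mul0r mulr0.
- by rewrite cdfunE mulf_neq0 //; apply/eqP => /pP /eqP; rewrite (negbTE xp').
- by rewrite (fa x' i xp' zx) mulrC subrr; exact: abs_le0x.
Qed.

End Realization.

(** * The main equivalences *)

(** By pigeonhole: otherwise [F] would put one more distinct element into [l] than its length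
    allows. *)
Lemma descent_stops (T : eqType) (A : T -> Prop) (l : seq T) (F : nat -> T) (stop : T) :
  (forall a, A a -> a \in l) -> injective F -> A (F 0%N) ->
  (forall n, A (F n) -> F n = stop \/ A (F n.+1)) -> exists n, F n = stop.
Proof.
move=> Al Finj A0 AS; apply: contrapT => nF.
have AF n : A (F n).
  by elim: n => // n /AS[Fn|//]; case: nF; exists n.
have : (size (map F (iota 0 (size l).+1)) <= size l)%N.
  apply: uniq_leq_size; first by rewrite map_inj_uniq ?iota_uniq.
  by move=> _ /mapP[n _ ->]; exact: Al.
by rewrite size_map size_iota ltnn.
Qed.

Section MainEquivalence.
Variables (K : ovfield) (L : language) (S : structure L K).
Hypothesis finK : forall D : set (1.-tuple K), definable (expansion S) D ->
  closed_set D -> bounded_set D -> discrete_set D -> finite_set D.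
Variables (m : nat) (X : definable_set S m) (h p t : cdfun X) (p0 : X).
Hypothesis pP : forall x : X, p x = 0 <-> x = p0.
Hypothesis germs : arbitrarily_many_germs S X (\val p0).
Local Notation B := (@unit_ball_functions K L S m X).

Lemma codes_finite_seq (f g s : cdfun X) : codes_finite B p f g s ->
  exists l : seq K, forall a, cluster_value p0 f g s a -> a \in l.
Proof.
move=> /(codes_finiteP pP); apply: separated_finite finK _ _.
exact: definable_cluster_value.
Qed.

(* [minn i n] repeats the last value, so that there are at least two germs. *)
Lemma code_initial_segment n (F : nat -> K) :
  exists f g s : cdfun X, codes_finite B p f g s /\
    forall c, cluster_value p0 f g s c <-> exists2 j, (j <= n)%N & c = F j.
Proof.
have [f [g [s H]]] := realize_cluster_values pP (fun i : 'I_n.+2 => F (minn i n)) isT germs.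
exists f, g, s; split.
  apply/(codes_finiteP pP).
  apply: (@finite_separated _ [seq F (minn (val i) n) | i : 'I_n.+2]) => c /H[i ->].
  by apply: (map_f (fun i : 'I_n.+2 => F (minn i n))); rewrite mem_enum.
move=> c; rewrite H; split=> [[i ->]|[j jn ->]]; first by exists (minn i n); rewrite ?geq_minr.
have j2 : (j < n.+2)%N by rewrite ltnS (leq_trans jn).
by exists (Ordinal j2); rewrite /= (minn_idPl jn).
Qed.

Lemma ovO_expr (a : K) n : ovO K a -> ovO K (a ^+ n).
Proof.
by move=> Oa; elim: n => [|n IH]; rewrite ?expr0 ?exprS; [exact: ovO1|exact: ovOM].
Qed.

(** Two equal powers would make 1 a multiple of [a] by an element of [O], against [abs_lt a 1]. *)
Lemma expr_inj_small (a : K) : abs_lt 0 a -> abs_lt a 1 -> injective (fun n => a ^+ n).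
Proof.
move=> [_ a0] [a1 na1].
have {}a0 : a != 0 by apply/eqP => az; apply: a0; rewrite az; exact: abs_lexx.
have Oa : ovO K a by move: a1; rewrite abs_leE ?oner_neq0 // divr1.
have ne n d : a ^+ n <> a ^+ (n + d.+1).
  rewrite -[LHS]mulr1 exprD => /(mulfI (expf_neq0 n a0)) ad; apply: na1.
  by exists (a ^+ d); [exact: ovO_expr|rewrite ad exprS].
move=> i j; case: (ltngtP i j) => // ij aij.
  by case: (ne i (j - i.+1)%N); rewrite aij; congr (a ^+ _); rewrite addnS -addSn subnKC.
by case: (ne j (i - j.+1)%N); rewrite -aij; congr (a ^+ _); rewrite addnS -addSn subnKC.
Qed.

Lemma int_mulP : abs_lt 0 (t p0) -> abs_lt (t p0) 1 ->
  int_mul B h p t <-> exists k : int, h p0 = t p0 ^ k.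
Proof.
move=> t_gt0 t_lt1; have texp := expr_inj_small t_gt0 t_lt1.
have t0 : t p0 != 0.
  by case: t_gt0 => _ t0; apply/eqP => tz; apply: t0; rewrite tz; exact: abs_lexx.
split=> [[f [g [s [cf [step [h1 [Ah1 [h10 last]]]]]]]]|[k hk]].
  have [l Al] := codes_finite_seq cf.
  move/(not_vanishes_atP pP): h10 => h10; move/(adherentP pP): Ah1 => Ah1.
  (* Since [h1 p0] is nonzero, the successive quotients are distinct and the descent has to stop. *)
  have [n nE] : exists n, h1 p0 / t p0 ^+ n = 1.
    apply: (descent_stops Al); last move=> n /= An.
    - by move=> i j /(mulfI h10) /invr_inj /texp.
    - by rewrite expr0 divr1.
    have [|v1|[h2 [/(adherentP pP) Ah2]]] := step (cdfun_cst X (h1 p0 / t p0 ^+ n)).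
    - exact/(adherentP pP).
    - move/(vanishes_atP pP): v1 => v1; left; apply/eqP; rewrite -subr_eq0.
      exact/eqP.
    - move=> /(vanishes_atP pP); rewrite !cdfunE => /eqP; rewrite subr_eq0 => /eqP h2E.
      right; suff -> : h1 p0 / t p0 ^+ n.+1 = h2 p0 by [].
      by rewrite exprSr invfM mulrA -h2E mulfK.
  have {}nE : h1 p0 = t p0 ^+ n.
    by rewrite -[LHS](divfK (expf_neq0 n t0)) nE mul1r.
  case: last => /(vanishes_atP pP); rewrite !cdfunE => /eqP; rewrite subr_eq0 => /eqP hE.
    by exists n; rewrite -hE nE.
  exists (- n%:Z); rewrite -exprnN; apply: (mulfI (expf_neq0 n t0)).
  by rewrite -nE hE nE mulfV // expf_neq0.
pose n := `|k|%N; have [f [g [s [cf clE]]]] := code_initial_segment n (fun j => t p0 ^+ j).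
exists f, g, s; split=> //; split.
  move=> h1 /(adherentP pP) /clE[[|j] jn h1E]; [left|right].
    by apply/(vanishes_atP pP); rewrite !cdfunE h1E expr0 subrr.
  exists (cdfun_cst X (t p0 ^+ j)); split.
    by apply/(adherentP pP)/clE; exists j => //; exact: ltnW.
  by apply/(vanishes_atP pP); rewrite !cdfunE h1E -exprSr subrr.
exists (cdfun_cst X (t p0 ^+ n)); split; first by apply/(adherentP pP)/clE; exists n.
split; first by apply/(not_vanishes_atP pP); rewrite cdfunE expf_neq0.
(* [Negz n] stands for [- (n + 1)], whose absolute value reduces to [n.+1]; this case uses the
   inverse of [h]. *)
rewrite {}/n in clE *; case: k hk clE => n hk _ /=; [left|right];
  apply/(vanishes_atP pP); rewrite !cdfunE hk; first by rewrite subrr.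
by rewrite NegzE -exprnN mulfV ?subrr // expf_neq0.
Qed.

Lemma int_addP : injective (fun n => t p0 *+ n) ->
  int_add B h p t <-> exists k : int, h p0 = t p0 *~ k.
Proof.
move=> tmul; split=> [[f [g [s [cf [step [h1 [Ah1 last]]]]]]]|[k hk]].
  have [l Al] := codes_finite_seq cf.
  move/(adherentP pP): Ah1 => Ah1.
  have [n nE] : exists n, h1 p0 - t p0 *+ n = 0.
    apply: (descent_stops Al); last move=> n /= An.
    - by move=> i j /addrI /oppr_inj /tmul.
    - by rewrite mulr0n subr0.
    have [|v1|[h2 [/(adherentP pP) Ah2]]] := step (cdfun_cst X (h1 p0 - t p0 *+ n)).
    - exact/(adherentP pP).
    - by left; move/(vanishes_atP pP): v1.
    - move=> /(vanishes_atP pP); rewrite !cdfunE => /eqP; rewrite subr_eq0 => /eqP h2E.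
      right; suff -> : h1 p0 - t p0 *+ n.+1 = h2 p0 by [].
      by rewrite mulrSr opprD addrA -h2E addrK.
  move/eqP: nE; rewrite subr_eq0 => /eqP nE.
  case: last => /(vanishes_atP pP); rewrite !cdfunE => /eqP.
    by rewrite subr_eq0 => /eqP hE; exists n; rewrite -hE nE.
  rewrite addrC addr_eq0 => /eqP hE; exists (- n%:Z).
  by rewrite hE nE mulrNz pmulrn.
pose n := `|k|%N; have [f [g [s [cf clE]]]] := code_initial_segment n (fun j => t p0 *+ j).
exists f, g, s; split=> //; split.
  move=> h1 /(adherentP pP) /clE[[|j] jn h1E]; [left|right].
    by apply/(vanishes_atP pP); rewrite h1E mulr0n.
  exists (cdfun_cst X (t p0 *+ j)); split.
    by apply/(adherentP pP)/clE; exists j => //; exact: ltnW.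
  by apply/(vanishes_atP pP); rewrite !cdfunE h1E -mulrSr subrr.
exists (cdfun_cst X (t p0 *+ n)); split; first by apply/(adherentP pP)/clE; exists n.
rewrite {}/n in clE *; case: k hk clE => n hk _ /=; [left|right];
  apply/(vanishes_atP pP); rewrite !cdfunE hk; first by rewrite pmulrn subrr.
by rewrite NegzE mulrNz pmulrn subrr.
Qed.

End MainEquivalence.

(** Equal multiples would give a positive multiple of [a] equal to 0; that multiple is at least [a],
    so antisymmetry forces [a = 0]. *)
Lemma ordered_mulrn_inj (V : zmodType) (le : rel V) (a : V) :
  total_order le -> compatible_add le -> le 0 a -> a != 0 ->
  injective (fun n => a *+ n).
Proof.
move=> [lexx lea let_ _] leD a_ge0 a0.
have ge0 n : le 0 (a *+ n).
  elim: n => [|n IH]; first exact: lexx.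
  by apply: (let_ _ _ _ a_ge0); have := leD _ _ a IH; rewrite add0r mulrSr.
have ne n d : a *+ n <> a *+ (n + d.+1).
  rewrite -[LHS]addr0 mulrnDr => /addrI /esym ad; case/eqP: a0; apply: lea.
  by rewrite a_ge0 andbT; have := leD _ _ a (ge0 d); rewrite add0r -mulrSr ad.
move=> i j; case: (ltngtP i j) => // ij aij.
  by case: (ne i (j - i.+1)%N); rewrite aij; congr (a *+ _); rewrite addnS -addSn subnKC.
by case: (ne j (i - j.+1)%N); rewrite -aij; congr (a *+ _); rewrite addnS -addSn subnKC.
Qed.

Theorem theorem5p5 (K : ovfield) (L : language) (S : structure L K)
  (finK : forall D : set (1.-tuple K), definable (expansion S) D ->
    closed_set D -> bounded_set D -> discrete_set D -> finite_set D) :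
  (exists IntM : formula ring_pred_lang 3,
    forall (m : nat) (X : definable_set S m) (h p t : cdfun X) (p0 : X),
      (forall x : X, p x = 0 <-> x = p0) ->
      arbitrarily_many_germs S X (\val p0) ->
      abs_lt 0 (t p0) -> abs_lt (t p0) 1 ->
      (sat (cdfun_structure X) [tuple h; p; t] IntM <->
       exists k : int, h p0 = t p0 ^ k)) /\
  (forall (le : rel K) (r : nat) (a : r.-tuple K)
      (psi : formula ring_pred_lang (2 + r)),
    total_order le -> compatible_add le ->
    (forall x y, le x y <->
      sat (ring_pred_structure (ovO K)) [tuple of [:: x; y] ++ a] psi) ->
    exists IntA : formula ring_pred_lang (3 + r),
      forall (m : nat) (X : definable_set S m) (h p t : cdfun X) (p0 : X),
        (forall x : X, p x = 0 <-> x = p0) ->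
        arbitrarily_many_germs S X (\val p0) ->
        le 0 (t p0) -> t p0 != 0 ->
        (sat (cdfun_structure X)
           [tuple of [:: h; p; t] ++ map (cdfun_cst X) a] IntA <->
         exists k : int, h p0 = t p0 *~ k)).
Proof.
split.
  have [phi phiP] := int_mul_formula 0.
  exists phi => m X h p t p0 pP germs t_gt0 t_lt1.
  (* [cdfun_structure X] is convertible to [ring_pred_structure] at [unit_ball_functions]. *)
  apply: iff_trans (phiP _ (@unit_ball_functions K L S m X) [tuple h; p; t]) _.
  exact: (int_mulP finK h pP germs t_gt0 t_lt1).
move=> le r a psi le_total le_add _; have [phi phiP] := int_add_formula r.
exists phi => m X h p t p0 pP germs t_ge0 t0.
apply: iff_trans (phiP _ (@unit_ball_functions K L S m X)
  [tuple of [:: h; p; t] ++ map (cdfun_cst X) a]) _.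
exact: (int_addP finK h pP germs (ordered_mulrn_inj le_total le_add t_ge0 t0)).
Qed.
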